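(* For the urn model $M$ with parameters $m,c$ and initial composition $(W_0,B_0)$ described in the context, the limits $\lim_{n\to\infty}\mathbb{E}(W_n^s/n^s)$ exist. In particular, for the expected value $$\lim_{n\to\infty}\frac{\mathbb{E}(W_n)}{n}=\frac{W_0mc}{T_0},$$ and for the normalized second moment $$\lim_{n\to\infty}\frac{\mathbb{E}(W_n^2)}{n^2}=\frac{\Gamma(\frac{T_0}{mc})\Gamma(\frac{T_0-1}{mc})}{\Gamma(\lambda_1)\Gamma(\lambda_2)}\left(W_0^2+\frac{W_0c^2m}{T_0}\sum_{\ell=0}^{\infty}\frac{\ell+\frac{T_0-m}{mc}}{\ell+\frac{T_0-1}{mc}}\cdot\frac{\binom{\ell+\frac{T_0}{mc}}{\ell+1}\binom{\ell+\frac{T_0-1}{mc}}{\ell+1}}{\binom{\ell+\lambda_1}{\ell+1}\binom{\ell+\lambda_2}{\ell+1}}\right),$$ where $\lambda_{1,2}=\dfrac{-\frac12+mc+T_0\pm\frac12\sqrt{1+4mc(1+c)}}{mc}$. Moreover, for arbitrary $s\ge 1$ the limit of the normalized $s$-th moment can be expressed in terms of an infinite sum, $$\lim_{n\to\infty}\frac{\mathbb{E}(W_n^s)}{n^s}=\frac{\prod_{\ell=1}^{s}\Gamma(\frac{T_0+1-\ell}{mc})}{\prod_{\ell=1}^{s}\Gamma(\lambda_{\ell,s})}\left(W_0^s+\sum_{\ell=0}^{\infty}\frac{\beta_{\ell,s}}{\prod_{j=0}^{\ell}\alpha_{j,s}}\right),$$ with $\alpha_{j,s}$ and $\beta_{\ell,s}$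 as defined in the context, the $\beta_{\ell,s}$ involving moments of the form $\mathbb{E}(W_h^r)$ with $0\le h<\infty$ and $0\le r\le s-1$. Here $\lambda_{1,s},\dots,\lambda_{s,s}$ denote the roots, multiplied by minus one, of the polynomial in $x$ on the left-hand side of $$\frac{s!}{(mc)^s}\sum_{\ell=0}^{s}c^\ell\binom{m}{\ell}\binom{x\cdot mc+T_0-\ell}{s-\ell}=\prod_{\ell=1}^{s}(x+\lambda_{\ell,s}).$$
   Context: Urn model $M$: let $m\ge 2$ and $c\ge 1$ be integers. An urn initially contains $W_0$ white and $B_0$ black balls, where $W_0>0$, $B_0>0$, and $T_0=W_0+B_0\ge m$. At each discrete time step $m$ balls are drawn at random without replacement from the urn. If $m-\ell$ white balls and $\ell$ black balls have been drawn ($0\le\ell\le m$), the drawn balls are returned to the urn together with $c(m-\ell)$ additional white balls and $c\ell$ additional black balls. $W_n$ and $B_n$ denote the numbers of white and black balls after $n$ draws; the total is $T_n=W_n+B_n=T_0+nmc$. Thus, given the first $n-1$ draws, the probability that the $n$-th sample has exactly $k$ white balls is $\binom{W_{n-1}}{k}\binom{T_{n-1}-W_{n-1}}{m-k}/\binom{T_{n-1}}{m}$, $0\le k\le m$, and then $W_n=W_{n-1}+kc$. Define $$\alpha_{n,s}=\sum_{\ell=0}^{s}c^\ell\,\frac{\binom{s}{\ell}\binom{m}{\ell}}{\binom{T_n}{\ell}},\qquad \beta_{n,s}=\sum_{i=2}^{s}\mathbb{E}(W_n^{s+1-i})\sum_{\ell=i}^{s}\binom{s}{\ell}c^\ell\sum_{j=\ell+1-i}^{\ell}(-1)^{j+i-1-\ell}\,\frac{S_2(\ell,j)\,S_1(j,\ell+1-i)\,\binom{m}{j}}{\binom{T_n}{j}},$$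 where $S_2(n,k)$ denotes a Stirling number of the second kind and $S_1(n,k)$ an unsigned Stirling number of the first kind. For a number or indeterminate $y$ and an integer $k\ge 0$, $\binom{y}{k}=y(y-1)\cdots(y-k+1)/k!$, and $\Gamma$ is the Gamma function.
   Formalization: For s > T_0 both Gamma products in the s-th moment formula have poles, so the printed quotient is undefined; it is read there as its limit when T_0 is replaced by T_0 + e·mc in both products and e → 0. For s ≤ T_0 it is the literal quotient. *)

(* Defs.v *)
From HB Require Import structures.
From mathcomp Require Import all_boot all_order all_algebra.
From mathcomp Require Import all_classical all_reals all_analysis.
From mathcomp Require Import complex.

Set Implicit Arguments.
Unset Strict Implicit.
Unset Printing Implicit Defensive.

Import Order.TTheory GRing.Theory Num.Theory.
Import numFieldNormedType.Exports.

Local Open Scope classical_set_scope.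
Local Open Scope ring_scope.
Local Open Scope complex_scope.

Fixpoint stirling2 (n k : nat) : nat :=
  match n, k with
  | 0, 0 => 1
  | 0, _.+1 => 0
  | _.+1, 0 => 0
  | n'.+1, k'.+1 => k * stirling2 n' k + stirling2 n' k'
  end%N.

(* unsigned *)
Fixpoint stirling1 (n k : nat) : nat :=
  match n, k with
  | 0, 0 => 1
  | 0, _.+1 => 0
  | _.+1, 0 => 0
  | n'.+1, k'.+1 => n' * stirling1 n' k + stirling1 n' k'
  end%N.

Definition gbinom (F : fieldType) (y : F) (k : nat) : F :=
  (\prod_(i < k) (y - i%:R)) / k`!%:R.

(* t ^ z for t > 0 *)
Definition cpowR (R : realType) (t : R) (z : R[i]) : R[i] :=
  (t `^ complex.Re z)%:C *
  (cos (complex.Im z * ln t) +i* sin (complex.Im z * ln t)).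

(* Euler's integral of t ^ (z - 1) * exp (- t) over t > 0, for 0 < Re z. *)
Definition Gamma_int (R : realType) (z : R[i]) : R[i] :=
  let f t := cpowR t (z - 1) * (expR (- t))%:C in
  (\int[lebesgue_measure]_(t in `]0, +oo[) complex.Re (f t)) +i*
  (\int[lebesgue_measure]_(t in `]0, +oo[) complex.Im (f t)).

(* The extension of Euler's integral by Gamma (z + 1) = z * Gamma z, where N is
   the least shift such that 0 < Re (z + N).  At the poles 0, -1, -2, ... one of
   the factors z + i vanishes and the value is 0 (division by zero). *)
Definition Gamma (R : realType) (z : R[i]) : R[i] :=
  let N := if 0 < complex.Re z then 0%N
           else (Num.truncn (- complex.Re z)).+1 in
  Gamma_int (z + N%:R) / \prod_(i < N) (z + i%:R).

Section Urn.
Context (R : realType) (d : measure_display) (Om : measurableType d).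
Variables (P : probability Om R) (m c W0 B0 : nat).

Definition total (n : nat) : nat := (W0 + B0 + n * m * c)%N.

(* Probability of k white balls in a sample of m balls drawn without
   replacement from an urn with w white balls among t balls (for k <= m). *)
Definition hypergeom (w t k : nat) : R :=
  ('C(w, k) * 'C(t - w, m - k))%:R / 'C(t, m)%:R.

(* K n is the number of white balls in the (n+1)-st sample. *)
Variable K : nat -> Om -> 'I_m.+1.

Definition white (n : nat) (x : Om) : nat := (W0 + c * \sum_(i < n) K i x)%N.

(* The law of the process: conditionally on the first n draws, the next one is
   hypergeometric for the current composition of the urn (in product form, so
   that histories of probability zero need no special treatment). *)
Record urn_process : Prop := UrnProcess {
  urn_measurable : forall n (j : 'I_m.+1), measurable [set x | K n x = j];
  urn_law : forall (n : nat) (k : nat -> 'I_m.+1),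
    P [set x | forall i, (i < n.+1)%N -> K i x = k i] =
    (P [set x | forall i, (i < n)%N -> K i x = k i] *
     (hypergeom (W0 + c * \sum_(i < n) k i)%N (total n) (k n))%:E)%E }.

Definition moment (n r : nat) : R :=
  fine ('E_P[(fun x => (white n x)%:R ^+ r)%R])%E.

(* In alpha and beta the binomial in a denominator can only vanish when
   'C(m, _) in the numerator does (as m <= total n); the term is then 0. *)
Definition alpha (n s : nat) : R :=
  \sum_(l < s.+1) c%:R ^+ l * ('C(s, l) * 'C(m, l))%:R / 'C(total n, l)%:R.

Definition beta (n s : nat) : R :=
  \sum_(2 <= i < s.+1) moment n (s + 1 - i) *
    \sum_(i <= l < s.+1) 'C(s, l)%:R * c%:R ^+ l *
      \sum_(l + 1 - i <= j < l.+1) (-1) ^+ (j + i - 1 - l) *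
        (stirling2 l j * stirling1 j (l + 1 - i) * 'C(m, j))%:R /
        'C(total n, j)%:R.

(* lam 1, ..., lam s are the roots, multiplied by minus one and listed with
   multiplicity, of the monic polynomial on the left-hand side; other values of
   lam are irrelevant. *)
Definition is_lambda (s : nat) (lam : nat -> R[i]) : Prop :=
  forall x : R[i],
    s`!%:R / (m * c)%:R ^+ s *
      \sum_(l < s.+1) c%:R ^+ l * 'C(m, l)%:R *
        gbinom (x * (m * c)%:R + (W0 + B0)%:R - l%:R) (s - l)
    = \prod_(1 <= l < s.+1) (x + lam l).

(* At e = 0 this is the quotient of Gamma products multiplying the series.  The
   shift e, i.e. replacing T_0 by T_0 + e * m * c in both products (this moves
   every root by the same amount), is needed when s > T_0: then Gamma has poles
   at the l-arguments with T_0 + 1 - l in -mc * {0, 1, ...}, they are cancelled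
   by as many poles among the Gamma (lam l), and the quotient is its limit as
   e tends to 0. *)
Definition Gamma_quot (s : nat) (lam : nat -> R[i]) (e : R) : R[i] :=
  (\prod_(1 <= l < s.+1)
     Gamma (((W0 + B0)%:R + 1 - l%:R) / (m * c)%:R + e%:C)) /
  (\prod_(1 <= l < s.+1) Gamma (lam l + e%:C)).

End Urn.

(* Main.v *)
(* The moments satisfy E(W_(n+1)^s) = alpha_n E(W_n^s) + beta_n: powers of the
   sample are written with falling factorials, whose hypergeometric means are
   explicit.  Hence, with A_n the product of alpha_0, ..., alpha_(n-1),
     E(W_n^s) = A_n (W_0^s + sum_(l < n) beta_l / A_(l+1)).
   Moreover alpha_j is the product over l of (j + lambda_l) / (j + b_l), where
   b_l = (T_0 + 1 - l) / (mc) and the lambda_l add up to s plus the sum of the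
   b_l, so that Gauss's product for Gamma gives A_n / n^s --> G, the quotient of
   Gamma products; as beta_l = O(l^(s-2)), the series converges absolutely.

   Gauss's product is obtained by integrating t^(z-1) (1 - t/n)^n over [1/n, n],
   where the primitive is elementary, and by dominated convergence; Fatou's lemma
   and a bound on Gauss's product for real z make t^(x-1) exp(-t) integrable.

   For s > T_0 some b_l are poles of Gamma.  The factors alpha_j(e) of the product
   shifted by e are nonincreasing in e and Lipschitz with a constant O(1/j^2), so
   A_n(e) and A_n(0) differ at most by a factor exp(C |e|), uniformly in n. *)

Require Import Defs.
From HB Require Import structures.
From mathcomp Require Import all_boot all_order all_algebra.
From mathcomp Require Import all_classical all_reals all_analysis.
From mathcomp Require Import complex measurable_realfun.
From mathcomp Require Import ring lra zify.

Set Implicit Arguments.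
Unset Strict Implicit.
Unset Printing Implicit Defensive.

Import Order.TTheory GRing.Theory Num.Theory.
Import numFieldNormedType.Exports.

Local Open Scope classical_set_scope.
Local Open Scope ring_scope.
Local Open Scope complex_scope.

(** * Complex powers *)

(** Dividing by the product of the [Gamma (lam l)], whose arguments may be complex, requires that
    Gamma has no zeros. This comes from Gauss's product itself: its modulus at [z] stays above a
    positive constant independent of [n], by comparison with the product at the real part of [z]. So
    at a shift [e] for which no argument is a pole, A_n(e) / n^s has a positive real limit. At
    [e = 0] that argument breaks down when poles occur. Existence of the limit then comes from
    monotonicity: for one fixed regular [e > 0] the ratio A_n(0) / A_n(e) is nondecreasing and
    bounded in [n]. Only afterwards is the limit identified as that of the Gamma quotients for [e]
    tending to 0. Probability enters through finite sums only: up to time [n] there are finitely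
    many histories, and every moment is a sum over them. *)

Lemma natC (R : rcfType) (n : nat) : (n%:R : R[i]) = n%:R%:C.
Proof. by rewrite rmorph_nat. Qed.

Lemma cReD (R : rcfType) (x y : R[i]) : complex.Re (x + y) = complex.Re x + complex.Re y.
Proof. by case: x y => [a b] [a' b']. Qed.

Lemma cImD (R : rcfType) (x y : R[i]) : complex.Im (x + y) = complex.Im x + complex.Im y.
Proof. by case: x y => [a b] [a' b']. Qed.

Lemma cReB (R : rcfType) (x y : R[i]) : complex.Re (x - y) = complex.Re x - complex.Re y.
Proof. by case: x y => [a b] [a' b']. Qed.

Lemma cImB (R : rcfType) (x y : R[i]) : complex.Im (x - y) = complex.Im x - complex.Im y.
Proof. by case: x y => [a b] [a' b']. Qed.

Lemma cReMr (R : rcfType) (x : R[i]) (r : R) : complex.Re (x * r%:C) = complex.Re x * r.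
Proof. by case: x => a b /=; rewrite mulr0 subr0. Qed.

(** Imaginary parts are real parts of a multiple. What is shown below for [complex.Re (a * _)] with
    arbitrary [a] thus covers both parts of Euler's integral. *)
Lemma cImE (R : rcfType) (x : R[i]) : complex.Im x = complex.Re (- 'i%C * x).
Proof. by case: x => a b /=; ring. Qed.

Lemma cRe_sum (R : rcfType) (I : Type) (r : seq I) (P : pred I) (F : I -> R[i]) :
  complex.Re (\sum_(i <- r | P i) F i) = \sum_(i <- r | P i) complex.Re (F i).
Proof. by apply: (big_morph _ (@cReD R)). Qed.

Lemma normcR (R : rcfType) (z : R[i]) : `|z| = (Normc.normc z)%:C.
Proof. by rewrite normc_def; case: z. Qed.

Lemma normc_ge0 (R : rcfType) (z : R[i]) : 0 <= Normc.normc z.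
Proof. by case: z => a b; apply: sqrtr_ge0. Qed.

Lemma normc_real (R : rcfType) (r : R) : Normc.normc r%:C = `|r|.
Proof. by rewrite /= expr0n addr0 sqrtr_sqr. Qed.

Lemma Re_le_norm (R : rcfType) (z : R[i]) : `|complex.Re z| <= Normc.normc z.
Proof.
case: z => a b /=; rewrite -sqrtr_sqr ler_sqrt ?lerDl ?sqr_ge0 //.
by rewrite addr_ge0 ?sqr_ge0.
Qed.

Section Cpow.
Variable R : realType.
Implicit Types (t : R) (z w : R[i]).

Lemma cpowRD t z w : 0 < t -> cpowR t (z + w) = cpowR t z * cpowR t w.
Proof.
move=> t0; rewrite /cpowR cReD cImD powRD ?(gt_eqF t0) ?implybT //.
rewrite mulrDl cosD sinD; case: z w => [a b] [a' b'] /=.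
by apply/eqP; rewrite eq_complex /=; apply/andP; split; apply/eqP; ring.
Qed.

Lemma cpowR_real t (x : R) : cpowR t x%:C = (t `^ x)%:C.
Proof. by rewrite /cpowR /= mul0r cos0 sin0 mulr1. Qed.

Lemma cpowR_nat t n : 0 < t -> cpowR t n%:R = (t ^+ n)%:C.
Proof. by move=> t0; rewrite natC cpowR_real powR_mulrn // ltW. Qed.

Lemma normc_cpowR t z : Normc.normc (cpowR t z) = t `^ complex.Re z.
Proof.
rewrite /cpowR Normc.normcM /= expr0n addr0 cos2Dsin2 sqrtr1 mulr1.
by rewrite sqrtr_sqr ger0_norm ?powR_ge0.
Qed.

Lemma cpowR_neq0 t z : 0 < t -> cpowR t z != 0.
Proof.
move=> t0; apply/eqP => h; have := normc_cpowR t z.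
by rewrite h Normc.normc0; apply/eqP; rewrite lt_eqF // powR_gt0.
Qed.

Lemma is_derive_cpowR (a w : R[i]) t : 0 < t ->
  is_derive t 1 (fun t => complex.Re (a * cpowR t w) : R)
    (complex.Re (a * w * cpowR t (w - 1))).
Proof.
move=> t0; case: a w => [a1 a2] [x y].
have scE (r : R) (v : R^o) : r *: v = r * v by [].
have dp := is_derive1_powR x t0.
have dl := is_derive1_ln t0.
have dyl : is_derive t 1 (fun u : R => y * ln u : R) (y * t^-1).
  have -> : (fun u : R => y * ln u : R) = y \*: (@ln R) by [].
  exact: is_deriveZ.
have dc : is_derive t 1 (fun u : R => cos (y * ln u)) (- sin (y * ln t) * (y * t^-1)).
  exact: (is_derive1_comp (is_derive_cos _) dyl).
have ds : is_derive t 1 (fun u : R => sin (y * ln u)) (cos (y * ln t) * (y * t^-1)).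
  exact: (is_derive1_comp (is_derive_sin _) dyl).
have -> : (fun u => complex.Re ((a1 +i* a2) * cpowR u (x +i* y))) =
  ((@powR R)^~ x * (a1 \*: (fun u => cos (y * ln u)) - a2 \*: (fun u => sin (y * ln u)))).
  apply/funext => u; rewrite /cpowR /= !fctE /= !scE; ring.
apply: is_derive_eq.
rewrite /cpowR /=.
have -> : t `^ x = t `^ (x - 1) * t.
  have := @powRD R t (x - 1) 1; rewrite subrK (powRr1 (ltW t0)) => -> //.
  by rewrite (gt_eqF t0) implybT.
rewrite subr0 !fctE /= !scE.
by field; rewrite gt_eqF.
Qed.

End Cpow.

(** * Gauss's product *)

Section GaussBounds.
Variable R : realType.
Implicit Types (x : R) (z w : R[i]).

Definition gauss z (n : nat) : R[i] :=
  cpowR n%:R z * n`!%:R / \prod_(i < n.+1) (z + i%:R).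

Definition gaussR x (n : nat) : R :=
  n%:R `^ x * n`!%:R / \prod_(i < n.+1) (x + i%:R).

Lemma gauss_real x n : gauss x%:C n = (gaussR x n)%:C.
Proof.
rewrite /gauss cpowR_real !natC /gaussR !rmorphM fmorphV rmorph_prod /=.
congr (_ / _); apply: eq_bigr => i _.
by rewrite natC rmorphD.
Qed.

Lemma prod_shift_gt0 x n : 0 < x -> 0 < \prod_(i < n) (x + i%:R).
Proof. by move=> x0; apply: prodr_gt0 => i _; rewrite ltr_wpDr. Qed.

Lemma powR_expR x (t : R) : 0 < t -> t `^ x = expR (x * ln t).
Proof. by move=> t0; rewrite /powR gt_eqF. Qed.


(** Since [ln (1 + 1/a) >= 1/(a+1)], the power [((a+1)/a)^x] is at least
    [exp (x/(a+1)) >= 1 + x/(a+1)]. This makes Gauss's product nondecreasing in [n] for real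
    [x > 0]. *)
Lemma powR_ratio_ge x (a : R) : 0 < x -> 0 < a ->
  a `^ x * (a + 1 + x) <= (a + 1) `^ x * (a + 1).
Proof.
move=> x0 a0; have a1 : 0 < a + 1 by rewrite addr_gt0.
rewrite !powR_expR // -[x * ln a](subrK (x * ln (a + 1))) addrC expRD -mulrA.
rewrite ler_pM2l ?expR_gt0 // -mulrBr -(ler_pM2l (expR_gt0 (- (x * (ln a - ln (a + 1)))))).
rewrite mulrA -expRD addNr expR0 mul1r -mulrN opprB.
have h : (a + 1)^-1 <= ln (a + 1) - ln a.
  have := @le_ln1Dx R (- (a + 1)^-1).
  have -> : 1 - (a + 1)^-1 = a / (a + 1) by field; rewrite gt_eqF.
  rewrite ln_div ?posrE // => /(_ _); rewrite ltrN2 invf_lt1 // ltrDr => /(_ a0).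
  lra.
apply: (@le_trans _ _ ((1 + x / (a + 1)) * (a + 1))).
  by rewrite mulrDl mul1r divfK // gt_eqF.
rewrite ler_pM2r //; apply: le_trans (expR_ge1Dx _) _.
by rewrite ler_expR ler_pM2l.
Qed.

(** From [ln (1 + u) <= u] and [1 - v <= exp (- v)]: [((b+x+1)/(b+x))^x <= exp (x/(b+x)) <=
    (b+x)/b]. This makes Gauss's product nonincreasing once [n^x] is replaced by [(n+1+x)^x]. *)
Lemma powR_ratio_le x (b : R) : 0 < x -> 0 < b ->
  (b + x + 1) `^ x * b <= (b + x) `^ x * (b + x).
Proof.
move=> x0 b0; have bx0 : 0 < b + x by rewrite addr_gt0.
have bx1 : 0 < b + x + 1 by rewrite addr_gt0.
rewrite !powR_expR //.
have h : ln (b + x + 1) - ln (b + x) <= (b + x)^-1.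
  have := @le_ln1Dx R (b + x)^-1.
  have -> : 1 + (b + x)^-1 = (b + x + 1) / (b + x) by field; rewrite gt_eqF.
  rewrite ln_div ?posrE // => /(_ _); apply.
  by rewrite (lt_trans (ltrN10 _)) // invr_gt0.
have h2 : 1 - x / (b + x) <= expR (- (x / (b + x))) := expR_ge1Dx _.
rewrite -(ler_pM2l (expR_gt0 (- (x * ln (b + x))))) !mulrA -!expRD addNr expR0 mul1r.
apply: (@le_trans _ _ (expR (x / (b + x)) * ((1 - x / (b + x)) * (b + x)))).
  rewrite mulrBl mul1r divfK ?gt_eqF // [b + x - x]addrK ler_pM2r // ler_expR.
  by rewrite addrC -mulrBr ler_pM2l.
rewrite mulrA -[leRHS]mul1r ler_pM2r //.
by apply: le_trans (ler_wpM2l (expR_ge0 _) h2) _; rewrite expRxMexpNx_1.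
Qed.

(** The bound is the value at [n = 1], from which the sequence does not decrease by
    [powR_ratio_ge]. *)
Lemma gaussR_ge x n : 0 < x -> (0 < n)%N -> (x * (x + 1))^-1 <= gaussR x n.
Proof.
move=> x0; case: n => // n _.
have x10 : 0 < x * (x + 1) by rewrite mulr_gt0 // addr_gt0.
rewrite ler_pdivlMr ?prod_shift_gt0 // mulrC ler_pdivrMr //.
elim: n => [|n IH].
  by rewrite !big_ord_recr big_ord0 /= mul1r addr0 powR1 factS fact0 muln1 !mul1r.
rewrite big_ord_recr /=; apply: le_trans (ler_wpM2r _ IH) _.
  by rewrite addr_ge0 // ltW.
have := @powR_ratio_ge x n.+1%:R x0 (ltr0Sn _ _).
rewrite [_ + 1 + x]addrC natr1 => h.
rewrite [n.+2`!]factS natrM [leLHS]mulrAC ler_pM2r // mulrAC.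
by rewrite [leRHS]mulrA ler_pM2r ?ltr0n ?fact_gt0.
Qed.

(** The larger sequence with [(n+1+x)^x] in place of [n^x] does not increase, and the bound is its
    value at [n = 0]. *)
Lemma gaussR_le x n : 0 < x -> gaussR x n <= (1 + x) `^ x / x.
Proof.
move=> x0; rewrite ler_pdivrMr ?prod_shift_gt0 // mulrAC ler_pdivlMr //.
apply: (@le_trans _ _ ((n.+1%:R + x) `^ x * n`!%:R * x)).
  rewrite ler_pM2r // ler_pM2r ?ltr0n ?fact_gt0 //.
  apply: ge0_ler_powR; rewrite ?nnegrE ?addr_ge0 // ?(ltW x0) //.
  by rewrite -[leLHS]addr0 lerD ?(ltW x0) // ler_nat.
elim: n => [|n IH].
  by rewrite !big_ord_recr big_ord0 /= mul1r addr0 fact0 mulr1.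
rewrite big_ord_recr /= mulrA; apply: le_trans _ (ler_wpM2r _ IH); last first.
  by rewrite addr_ge0 // ltW.
have := @powR_ratio_le x n.+1%:R x0 (ltr0Sn _ _).
rewrite addrAC natr1 => h.
rewrite [(n.+1)`!]factS natrM mulrA [leRHS]mulrAC ler_pM2r //.
by rewrite [leRHS]mulrAC ler_pM2r ?ltr0n ?fact_gt0 // (addrC x).
Qed.

(** With [u = y^2/(x+j)^2], [sqrt (1 + u) <= 1 + u <= exp u]. The exponents are summable over [j],
    so the complex product is controlled by the real one. *)
Lemma normc_add_nat_le (x y : R) j : 0 < x ->
  Normc.normc (x +i* y + j%:R) <= (x + j%:R) * expR (y ^+ 2 / (x + j%:R) ^+ 2).
Proof.
move=> x0; have a0 : 0 < x + j%:R by rewrite ltr_wpDr.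
rewrite natC /= addr0; set a := x + j%:R in a0 *.
apply: (@le_trans _ _ (a * (1 + y ^+ 2 / a ^+ 2))); last first.
  by rewrite ler_pM2l // expR_ge1Dx.
have p0 : 0 <= y ^+ 2 / a ^+ 2 by rewrite divr_ge0 ?sqr_ge0.
rewrite -(@ger0_norm _ (a * (1 + y ^+ 2 / a ^+ 2))); last first.
  by rewrite mulr_ge0 ?addr_ge0 // ltW.
rewrite -sqrtr_sqr ler_sqrt ?sqr_ge0 // exprMn.
have -> : a ^+ 2 + y ^+ 2 = a ^+ 2 * (1 + y ^+ 2 / a ^+ 2) by field; rewrite gt_eqF.
rewrite ler_pM2l ?exprn_gt0 // expr2 ler_peMr ?addr_ge0 // lerDl //.
Qed.

Lemma prod_normc_add_nat_le (x y : R) n : 0 < x ->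
  \prod_(i < n.+1) Normc.normc (x +i* y + i%:R) <=
  expR (y ^+ 2 * (x ^- 2 + x^-1)) * \prod_(i < n.+1) (x + i%:R).
Proof.
move=> x0; pose N j := Normc.normc (x +i* y + j%:R).
have N0 j : 0 <= N j by apply: normc_ge0.
have Nle j : N j <= (x + j%:R) * expR (y ^+ 2 / (x + j%:R) ^+ 2).
  exact: normc_add_nat_le.
rewrite -[leLHS]/(\prod_(i < n.+1) N i).
(* Strengthened for the induction: [(x+j+1)^-2 <= 1/(x+j) - 1/(x+j+1)] telescopes, and the term
   [(x+n)^-1] records where the sum stands. *)
move: N N0 Nle => N N0 Nle; apply: (@le_trans _ _
  (expR (y ^+ 2 * (x ^- 2 + x^-1 - (x + n%:R)^-1)) * \prod_(i < n.+1) (x + i%:R))).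
  elim: n => [|n IH].
    rewrite !big_ord1; apply: le_trans (Nle 0%N) _.
    by rewrite addr0 addrK mulrC.
  rewrite big_ord_recr [in leRHS]big_ord_recr /=.
  apply: le_trans (ler_pM _ (N0 _) IH (Nle _)) _; first exact: prodr_ge0.
  have a0 : 0 < x + n%:R by rewrite ltr_wpDr.
  have a1 : 0 < x + n.+1%:R by rewrite ltr_wpDr.
  rewrite [(x + _) * expR _]mulrC mulrACA ler_pM2r ?mulr_gt0 ?prod_shift_gt0 //.
  rewrite -expRD ler_expR -mulrDr ler_wpM2l ?sqr_ge0 //.
  set a := x + n%:R in a0 *.
  have e : x + n.+1%:R = a + 1 by rewrite /a -addrA natr1.
  rewrite e in a1 *.
  have : (a + 1) ^- 2 <= a^-1 - (a + 1)^-1.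
    have -> : a^-1 - (a + 1)^-1 = (a * (a + 1))^-1.
      by field; rewrite !gt_eqF.
    by rewrite expr2 lef_pV2 ?posrE ?mulr_gt0 // ler_pM2r // lerDl.
  lra.
rewrite ler_pM2r ?prod_shift_gt0 // ler_expR ler_wpM2l ?sqr_ge0 //.
by rewrite gerBl invr_ge0 addr_ge0 // ltW.
Qed.

Lemma normc_nat n : Normc.normc (n%:R : R[i]) = n%:R.
Proof. by rewrite natC /= expr0n addr0 sqrtr_sqr ger0_norm. Qed.

Lemma normc_gauss z n : Normc.normc (gauss z n) =
  n%:R `^ complex.Re z * n`!%:R / \prod_(i < n.+1) Normc.normc (z + i%:R).
Proof.
rewrite /gauss Normc.normcM Normc.normcV Normc.normcM normc_cpowR normc_nat; congr (_ / _).
apply: (big_morph _ (@Normc.normcM R)); exact: Normc.normc1.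
Qed.

(** The bound does not depend on [n], so the limit of Gauss's product is not 0. *)
Lemma normc_gauss_ge z n : 0 < complex.Re z -> (0 < n)%N ->
  expR (- (complex.Im z ^+ 2 * (complex.Re z ^- 2 + (complex.Re z)^-1))) *
  (complex.Re z * (complex.Re z + 1))^-1 <= Normc.normc (gauss z n).
Proof.
case: z => x y /= x0 n0.
apply: le_trans (ler_wpM2l (expR_ge0 _) (gaussR_ge x0 n0)) _.
rewrite normc_gauss /= expRN /gaussR [leLHS]mulrC -[leLHS]mulrA -invfM.
rewrite ler_wpM2l ?mulr_ge0 ?powR_ge0 // lef_pV2 ?posrE.
- by rewrite mulrC prod_normc_add_nat_le.
- by rewrite mulr_gt0 ?prod_shift_gt0 // expR_gt0.
- apply: prodr_gt0 => i _; rewrite natC /= sqrtr_gt0 ltr_pwDl ?sqr_ge0 //.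
  by rewrite exprn_gt0 // ltr_wpDr.
Qed.

(** The functional equation of Gamma at finite [n], up to a factor that tends to 1. *)
Lemma gauss_shift z n : (0 < n)%N -> z != 0 -> z + n.+1%:R != 0 ->
  gauss z n = gauss (z + 1) n * ((z + n.+1%:R) / n%:R) / z.
Proof.
move=> n0 z0 h; rewrite /gauss cpowRD ?ltr0n //.
have -> : cpowR n%:R 1 = n%:R :> R[i].
  by have := @cpowR_nat R n%:R 1; rewrite ltr0n expr1 -natC => ->.
set p := \prod_(i < n) (z + i.+1%:R).
have e1 : \prod_(i < n.+1) (z + i%:R) = z * p.
  by rewrite big_ord_recl /= addr0.
have e2 : \prod_(i < n.+1) (z + 1 + i%:R) = p * (z + n.+1%:R).
  rewrite big_ord_recr /= -addrA nat1r; congr (_ * _).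
  by apply: eq_bigr => i _; rewrite -addrA nat1r.
rewrite e1 e2 !invfM.
have nn : n%:R != 0 :> R[i] by rewrite pnatr_eq0 -lt0n.
rewrite [RHS](_ : _ = cpowR n%:R z * n`!%:R * (z^-1 * p^-1) *
  (n%:R / n%:R) * ((z + n.+1%:R) / (z + n.+1%:R))); last by ring.
by rewrite !divff // !mulr1.
Qed.

(** By Pascal's rule the sum for [n + 1] is the sum for [n] at [z] minus the sum for [n] at [z + 1];
    the right-hand side obeys the same recursion. *)
Lemma partial_fractions (F : fieldType) (z : F) n :
  (forall i : nat, z + i%:R != 0) ->
  \sum_(k < n.+1) (-1) ^+ k * 'C(n, k)%:R / (z + k%:R) =
  n`!%:R / \prod_(i < n.+1) (z + i%:R).
Proof.
elim: n z => [|n IH] z hz.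
  by rewrite big_ord1 big_ord1 expr0 bin0 mul1r fact0.
have hz1 i : z + 1 + i%:R != 0 by rewrite -addrA nat1r.
pose f (z : F) n := \sum_(k < n.+1) (-1) ^+ k * 'C(n, k)%:R / (z + k%:R) : F.
have -> : \sum_(k < n.+2) (-1) ^+ k * 'C(n.+1, k)%:R / (z + k%:R) =
  f z n - f (z + 1) n.
  rewrite big_ord_recl /= /f.
  under eq_bigr => i _ do rewrite binS natrD mulrDr mulrDl.
  rewrite big_split /= addrA; congr (_ + _).
    rewrite [in RHS]big_ord_recl /= !bin0; congr (_ + _).
    rewrite big_ord_recr /= bin_small // mulr0 mul0r addr0.
    by apply: eq_bigr.
  rewrite -sumrN; apply: eq_bigr => i _.
  by rewrite /bump /= add1n exprS mulN1r !mulNr -addrA nat1r.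
rewrite /f !IH //.
set p := \prod_(i < n) (z + i.+1%:R).
have e1 : \prod_(i < n.+1) (z + i%:R) = z * p.
  by rewrite big_ord_recl /= addr0.
have e2 : \prod_(i < n.+1) (z + 1 + i%:R) = p * (z + n.+1%:R).
  rewrite big_ord_recr /= -addrA nat1r; congr (_ * _).
  by apply: eq_bigr => i _; rewrite -addrA nat1r.
rewrite [in RHS]big_ord_recr /= e1 e2 factS natrM.
have p0 : p != 0 by apply/prodf_neq0 => i _.
have := hz 0%N; rewrite addr0 => z0; have zn := hz n.+1.
by field; rewrite nat1r z0 zn p0.
Qed.

End GaussBounds.

(** * Euler's integral *)

Section GammaIntegral.
Variable R : realType.
Implicit Types (a z w : R[i]) (t : R).
Notation mu := (@lebesgue_measure R).

Lemma continuous_is_derive (f : R -> R) t df : is_derive t 1 f df ->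
  {for t, continuous f}.
Proof.
by move=> h; apply/differentiable_continuous; rewrite -derivable1_diffP; case: h.
Qed.

Lemma cpowRDn t z k : 0 < t -> cpowR t (z + k%:R) = cpowR t z * (t ^+ k)%:C.
Proof. by move=> t0; rewrite cpowRD // cpowR_nat. Qed.

Lemma one_sub_exp (n : nat) t :
  \sum_(k < n.+1) (-1) ^+ k * 'C(n, k)%:R / n%:R ^+ k * t ^+ k = (1 - t / n%:R) ^+ n.
Proof.
rewrite exprBn; apply: eq_bigr => k _.
by rewrite expr1n mulr1 expr_div_n -mulr_natr; ring.
Qed.

Lemma continuous_one_sub_exp (n : nat) : continuous (fun t : R => (1 - t / n%:R) ^+ n).
Proof.
move=> t; apply: (@continuous_comp _ _ _ (fun t : R => 1 - t / n%:R) (fun u => u ^+ n)).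
  by apply: cvgB; [exact: cvg_cst|apply: cvgMl; exact: cvg_id].
exact: exprn_continuous.
Qed.

(* A primitive of t ^ (z - 1) * (1 - t / n) ^ n. *)
Definition euler_prim z n t : R[i] :=
  \sum_(k < n.+1) ((-1) ^+ k * 'C(n, k)%:R / n%:R ^+ k)%:C *
    (z + k%:R)^-1 * cpowR t (z + k%:R).

Lemma is_derive_euler_prim a z n t : 0 < t -> (forall i : nat, z + i%:R != 0) ->
  is_derive t 1 (fun t => complex.Re (a * euler_prim z n t) : R)
    (complex.Re (a * cpowR t (z - 1)) * (1 - t / n%:R) ^+ n).
Proof.
move=> t0 hz.
pose co (k : nat) : R := (-1) ^+ k * 'C(n, k)%:R / n%:R ^+ k.
pose b (k : nat) := a * ((co k)%:C * (z + k%:R)^-1).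
have -> : (fun t => complex.Re (a * euler_prim z n t)) =
  \sum_(k < n.+1) (fun t => complex.Re (b k * cpowR t (z + k%:R)) : R).
  apply/funext => u; rewrite fct_sumE /euler_prim mulr_sumr cRe_sum.
  by apply: eq_bigr => k _; rewrite /b /co -!mulrA.
apply: is_derive_eq; first by apply: is_derive_sum => k; exact: is_derive_cpowR.
rewrite -one_sub_exp mulr_sumr; apply: eq_bigr => k _.
transitivity (complex.Re (a * cpowR t (z - 1) * (co k * t ^+ k)%:C)); last exact: cReMr.
congr (complex.Re _).
rewrite (_ : z + k%:R - 1 = z - 1 + k%:R); last by ring.
rewrite cpowRDn // /b.
rewrite -[in LHS](mulrA a) -(mulrA _ _ (z + k%:R)) mulVf // mulr1 -/(co k).
rewrite -mulrA -mulrA; congr (_ * _).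
by rewrite mulrCA -rmorphM.
Qed.

(** The lower end must stay positive: [t^(z-1)] is unbounded at 0 when the real part of [z] is below
    1. *)
Lemma integral_euler_trunc a z n (e A : R) : 0 < e -> e < A ->
  (forall i : nat, z + i%:R != 0) ->
  (\int[mu]_(t in `[e, A])
     (complex.Re (a * cpowR t (z - 1)) * (1 - t / n%:R) ^+ n)%:E =
   (complex.Re (a * euler_prim z n A))%:E - (complex.Re (a * euler_prim z n e))%:E)%E.
Proof.
move=> e0 eA hz.
have dF t : 0 < t -> is_derive t 1 (fun t => complex.Re (a * euler_prim z n t) : R)
    (complex.Re (a * cpowR t (z - 1)) * (1 - t / n%:R) ^+ n).
  by move=> t0; apply: is_derive_euler_prim.
apply: (@continuous_FTC2 R _ (fun t => complex.Re (a * euler_prim z n t))) => //.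
- apply: continuous_in_subspaceT => t; rewrite inE /= in_itv /= => /andP[et _].
  have t0 : 0 < t := lt_le_trans e0 et.
  apply: cvgM; first exact: continuous_is_derive (is_derive_cpowR _ _ t0).
  exact: continuous_one_sub_exp.
- split.
  + by move=> t /[!in_itv] /= /andP[et _]; have [] := dF t (lt_trans e0 et).
  + by apply: cvg_at_right_filter; apply: continuous_is_derive (dF _ _).
  + by apply: cvg_at_left_filter; apply: continuous_is_derive (dF _ (lt_trans e0 eA)).
- move=> t /[!in_itv] /= /andP[et _].
  by rewrite derive1E; have [_ ->] := dF t (lt_trans e0 et).
Qed.

Lemma Re_shift_neq0 z (i : nat) : 0 < complex.Re z -> z + i%:R != 0.
Proof.
move=> z0; apply/eqP => /(congr1 (@complex.Re R)); rewrite cReD natC /= => h.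
by have := ltr_wpDr (ler0n R i) z0; rewrite h ltxx.
Qed.

(** At [t = n] the powers [n^k] cancel, and what is left is the partial fraction expansion of
    Gauss's product. *)
Lemma euler_prim_gauss z n : (0 < n)%N -> 0 < complex.Re z ->
  euler_prim z n n%:R = gauss z n.
Proof.
move=> n0 z0.
have nn : (n%:R : R[i]) != 0 by rewrite pnatr_eq0 -lt0n.
rewrite /gauss -mulrA -partial_fractions; last by move=> i; apply: Re_shift_neq0.
rewrite mulr_sumr; apply: eq_bigr => k _.
have zk : z + k%:R != 0 by apply: Re_shift_neq0.
have nk : (n%:R : R[i]) ^+ k != 0 by rewrite expf_neq0.
rewrite cpowRDn ?ltr0n // rmorphM fmorphV rmorphM !rmorphXn rmorphN1 !rmorph_nat /=.
by field; rewrite zk nk.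
Qed.

Lemma normc_shift_ge z (k : nat) : 0 < complex.Re z ->
  complex.Re z <= Normc.normc (z + k%:R).
Proof.
move=> z0; apply: le_trans (Re_le_norm _); rewrite cReD natC /=.
by rewrite ger0_norm ?addr_ge0 ?(ltW z0) // lerDl.
Qed.

Lemma normc_sum_le (I : Type) (r : seq I) (P : pred I) (F : I -> R[i]) :
  Normc.normc (\sum_(i <- r | P i) F i) <= \sum_(i <- r | P i) Normc.normc (F i).
Proof.
elim/big_ind2: _ => [|x a y b h1 h2|//]; first by rewrite Normc.normc0.
exact: le_trans (le_normcD _ _) (lerD h1 h2).
Qed.

(** Taking moduli term by term drops the alternating signs, so [(1 - t/n)^n] turns into
    [(1 + t/n)^n]; this is harmless for the small [t] at which it is used. *)
Lemma normc_euler_prim z n t : 0 < t -> 0 < complex.Re z ->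
  Normc.normc (euler_prim z n t) <=
    t `^ complex.Re z / complex.Re z * (1 + t / n%:R) ^+ n.
Proof.
move=> t0 z0; apply: le_trans (normc_sum_le _ _ _) _.
rewrite exprDn mulr_sumr; apply: ler_sum => k _.
rewrite cpowRDn // Normc.normcM [X in X * _]Normc.normcM [X in _ * X]Normc.normcM.
rewrite Normc.normcV normc_cpowR !normc_real !normrM normfV !normrX normrN1 expr1n.
rewrite !normr_nat (gtr0_norm t0) expr1n !mul1r expr_div_n -mulr_natr.
have cz : (Normc.normc (z + k%:R))^-1 <= (complex.Re z)^-1.
  by rewrite lef_pV2 ?normc_shift_ge // posrE // (lt_le_trans z0) ?normc_shift_ge.
rewrite [leRHS](_ : _ = 'C(n, k)%:R / n%:R ^+ k * (complex.Re z)^-1 *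
   (t `^ complex.Re z * t ^+ k)); last by ring.
apply: ler_wpM2r; first by rewrite mulr_ge0 ?powR_ge0 ?exprn_ge0 // ltW.
by rewrite mul1r; apply: ler_wpM2l => //; rewrite divr_ge0 ?exprn_ge0.
Qed.

Lemma invn_cvg0 : (n%:R^-1 : R) @[n --> \oo] --> (0 : R).
Proof. by rewrite -cvg_shiftS /=; exact: cvg_harmonic. Qed.

Lemma powR_invn_cvg0 (x : R) : 0 < x -> (n%:R^-1 `^ x) @[n --> \oo] --> (0 : R).
Proof.
move=> x0; have := powR_cvg0 x0.
move/cvg_at_rightP => /(_ (fun n => n.+1%:R^-1)) h.
rewrite -cvg_shiftS /=; apply: h; split; last exact: cvg_harmonic.
by move=> n; rewrite /= invr_gt0.
Qed.

(** At [t = 1/n] the last factor is [(1 + n^-2)^n <= exp 1], so the lower end of the integral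
    contributes a multiple of [n^(- Re z)], which vanishes in the limit. *)
Lemma euler_prim_inv_le a z n : (0 < n)%N -> 0 < complex.Re z ->
  `|complex.Re (a * euler_prim z n n%:R^-1)| <=
    Normc.normc a * (expR 1 / complex.Re z) * n%:R^-1 `^ complex.Re z.
Proof.
move=> n0 z0; have n1 : 0 < n%:R^-1 :> R by rewrite invr_gt0 ltr0n.
apply: le_trans (Re_le_norm _) _; rewrite Normc.normcM -mulrA.
rewrite ler_wpM2l ?normc_ge0 //; apply: le_trans (normc_euler_prim _ n1 z0) _.
rewrite -mulrA [leRHS]mulrC.
apply: ler_wpM2l; first exact: powR_ge0.
rewrite mulrC ler_wpM2r ?invr_ge0 ?(ltW z0) //.
apply: (@le_trans _ _ (expR (n%:R^-1 / n%:R) ^+ n)).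
  by rewrite lerXn2r ?nnegrE ?expR_ge0 ?addr_ge0 ?divr_ge0 ?expR_ge1Dx // ltW.
rewrite -expRM_natr divfK ?pnatr_eq0 -?lt0n // ler_expR invf_le1 ?ltr0n //.
by rewrite ler1n.
Qed.

Lemma euler_prim_inv_cvg a z : 0 < complex.Re z ->
  complex.Re (a * euler_prim z n n%:R^-1) @[n --> \oo] --> (0 : R).
Proof.
move=> z0; apply/norm_cvg0P.
pose K := Normc.normc a * (expR 1 / complex.Re z).
apply: (@squeeze_cvgr _ _ _ _ (fun=> 0) (fun n => K * n%:R^-1 `^ complex.Re z)).
- near=> n; rewrite normr_ge0 /= euler_prim_inv_le //.
  by near: n; exists 1%N.
- exact: cvg_cst.
- rewrite -[0](mulr0 K); apply: cvgMr; exact: powR_invn_cvg0.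
Unshelve. all: by end_near. Qed.

(** Extended by 0 outside the interval, so that all [n] share one domain of integration, as Fatou's
    lemma and dominated convergence require. *)
Definition euler_trunc a z (n : nat) : R -> R :=
  (fun t => complex.Re (a * cpowR t (z - 1)) * (1 - t / n%:R) ^+ n)
    \_ `[n%:R^-1, n%:R].

(** With [u = t/n], the inequality [1 + u <= exp u] gives [exp (- u) (1 - u^2) <= 1 - u]; its [n]-th
    power is then bounded below by Bernoulli's inequality for [(1 - u^2)^n]. *)
Lemma expR_lower (n : nat) t : (0 < n)%N -> 0 <= t -> t <= n%:R ->
  expR (- t) * (1 - t ^+ 2 / n%:R) <= (1 - t / n%:R) ^+ n.
Proof.
move=> n0 t0 tn; have n0' : 0 < n%:R :> R by rewrite ltr0n.
set u := t / n%:R.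
have u0 : 0 <= u by rewrite divr_ge0.
have u1 : u <= 1 by rewrite ler_pdivrMr // mul1r.
have u2 : 0 <= 1 - u ^+ 2 by rewrite subr_ge0 expr_le1.
have h : expR (- u) * (1 - u ^+ 2) <= 1 - u.
  have -> : 1 - u ^+ 2 = (1 + u) * (1 - u) by ring.
  rewrite mulrA -[leRHS]mul1r ler_wpM2r ?subr_ge0 //.
  rewrite expRN mulrC ler_pdivrMr ?expR_gt0 // mul1r; exact: expR_ge1Dx.
have -> : - t = - u * n%:R by rewrite /u mulNr divfK // gt_eqF.
rewrite expRM_natr; apply: (@le_trans _ _ (expR (- u) ^+ n * (1 - u ^+ 2) ^+ n)).
  rewrite ler_wpM2l ?exprn_ge0 ?expR_ge0 //.
  have -> : t ^+ 2 / n%:R = n%:R * u ^+ 2 by rewrite /u; field; rewrite gt_eqF.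
  elim: (n) => [|k IH]; first by rewrite mul0r subr0 expr0.
  rewrite [leRHS]exprS; apply: le_trans _ (ler_wpM2l u2 IH).
  have : 0 <= k%:R * u ^+ 2 * u ^+ 2 by rewrite !mulr_ge0 ?sqr_ge0.
  by rewrite -natr1; lra.
rewrite -exprMn lerXn2r ?nnegrE ?subr_ge0 ?mulr_ge0 ?expR_ge0 //.
Qed.

Lemma one_sub_exp_cvg t : 0 <= t -> (1 - t / n%:R) ^+ n @[n --> \oo] --> expR (- t).
Proof.
move=> t0.
apply: (@squeeze_cvgr _ _ _ _ (fun n => expR (- t) * (1 - t ^+ 2 / n%:R)) (fun=> expR (- t))).
- near=> n; have n0 : (0 < n)%N by near: n; exists 1%N.
  have n0' : 0 < n%:R :> R by rewrite ltr0n.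
  have tn : t <= n%:R by near: n; exact: nbhs_infty_ger.
  rewrite expR_lower //=.
  have -> : - t = - (t / n%:R) * n%:R by rewrite mulNr divfK // gt_eqF.
  rewrite expRM_natr lerXn2r ?nnegrE ?expR_ge0 ?expR_ge1Dx //.
  by rewrite subr_ge0 ler_pdivrMr // mul1r.
- rewrite -[X in _ --> X]mulr1 -[X in _ * X]subr0 -(mulr0 (t ^+ 2)).
  apply: cvgMr; apply: cvgB; first exact: cvg_cst.
  apply: cvgMr; exact: invn_cvg0.
- exact: cvg_cst.
Unshelve. all: by end_near. Qed.

End GammaIntegral.

(** * Passage to the limit in Euler's integral *)

Section GammaLimit.
Variable R : realType.
Implicit Types (a z w : R[i]) (t : R).
Notation mu := (@lebesgue_measure R).
Local Notation D := (`]0, +oo[%classic : set R).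

Lemma in_D t : D t = (0 < t) :> Prop.
Proof. by rewrite /= in_itv /= andbT. Qed.

Lemma measurable_Re_cpowR a w : measurable_fun D (fun t => complex.Re (a * cpowR t w) : R).
Proof.
apply: open_continuous_measurable_fun; first exact: interval_open.
move=> t; rewrite inE in_D => t0.
exact: continuous_is_derive (is_derive_cpowR _ _ t0).
Qed.

Definition euler_integrand a z t : R := complex.Re (a * cpowR t (z - 1)) * expR (- t).

Lemma euler_integrand_real (x : R) t :
  euler_integrand 1 x%:C t = t `^ (x - 1) * expR (- t).
Proof.
have e1 : x%:C - 1 = (x - 1)%:C by rewrite rmorphB rmorph1.
by rewrite /euler_integrand mul1r e1 cpowR_real.
Qed.

Lemma measurable_euler_integrand a z : measurable_fun D (euler_integrand a z).
Proof.
apply: measurable_funM; first exact: measurable_Re_cpowR.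
by apply: measurable_funTS; apply: measurableT_comp => //; exact: measurable_funN.
Qed.

Lemma measurable_euler_trunc a z n : measurable_fun D (euler_trunc a z n).
Proof.
apply/measurable_restrict => //.
apply: measurable_funM.
  exact: measurable_funS (measurable_Re_cpowR _ _).
apply: measurable_funTS; exact: continuous_measurable_fun (@continuous_one_sub_exp R n).
Qed.

Lemma euler_trunc_cvg a z t : 0 < t ->
  euler_trunc a z n t @[n --> \oo] --> euler_integrand a z t.
Proof.
move=> t0.
have h : complex.Re (a * cpowR t (z - 1)) * (1 - t / n%:R) ^+ n @[n --> \oo]
   --> euler_integrand a z t.
  by apply: cvgMr; apply: one_sub_exp_cvg; exact: ltW.
apply: cvg_trans h; apply: near_eq_cvg; near=> n.
have n0 : (0 < n)%N by near: n; exists 1%N.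
rewrite /euler_trunc patchE mem_set //= in_itv /=; apply/andP; split.
  rewrite -[leRHS]invrK lef_pV2 ?posrE ?ltr0n ?invr_gt0 //.
  by near: n; exact: nbhs_infty_ger.
by near: n; exact: nbhs_infty_ger.
Unshelve. all: by end_near. Qed.

(** The modulus of [t^(z-1)] depends on the real part of [z] only, and [1 - u <= exp (- u)] removes
    [n]: the dominating function is Euler's integrand at a real argument. *)
Lemma euler_trunc_le a z n t : 0 < t ->
  `|euler_trunc a z n t| <= Normc.normc a * euler_integrand 1 (complex.Re z)%:C t.
Proof.
move=> t0; rewrite euler_integrand_real /euler_trunc patchE.
case: ifPn => [|_]; last by rewrite normr0 !mulr_ge0 ?normc_ge0 ?powR_ge0 ?expR_ge0.
rewrite inE /= in_itv /= => /andP[nt tn].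
have n0' : 0 < n%:R :> R by rewrite (lt_le_trans t0).
have u0 : 0 <= 1 - t / n%:R by rewrite subr_ge0 ler_pdivrMr // mul1r.
rewrite normrM [leRHS]mulrA ler_pM //.
  apply: le_trans (Re_le_norm _) _; rewrite (Normc.normcM a) normc_cpowR.
  by rewrite cReD /=.
rewrite ger0_norm ?exprn_ge0 //.
have -> : - t = - (t / n%:R) * n%:R by rewrite mulNr divfK // gt_eqF.
by rewrite expRM_natr lerXn2r ?nnegrE ?expR_ge0 ?expR_ge1Dx.
Qed.

Lemma integral_euler_trunc_gauss a z n : (1 < n)%N -> 0 < complex.Re z ->
  (\int[mu]_(t in D) (euler_trunc a z n t)%:E =
   (complex.Re (a * gauss z n) - complex.Re (a * euler_prim z n n%:R^-1))%:E)%E.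
Proof.
move=> n1 z0; have n0 : (0 < n)%N by apply: ltnW.
have n0' : 0 < n%:R :> R by rewrite ltr0n.
have hz i : z + i%:R != 0 by apply: Re_shift_neq0.
rewrite -euler_prim_gauss // EFinB -integral_euler_trunc ?invr_gt0 //; last first.
  by rewrite (lt_trans _ (_ : 1 < _)) ?ltr1n // invf_lt1 ?ltr1n.
rewrite (_ : `[n%:R^-1, n%:R]%classic = D `&` `[n%:R^-1, n%:R]); last first.
  apply/seteqP; split => t /=; rewrite !in_itv /= ?andbT; last by case.
  by move=> /andP[h1 h2]; rewrite h1 h2 (lt_le_trans _ h1) // invr_gt0.
by rewrite integral_mkcondr; under [RHS]eq_integral do rewrite restrict_EFin.
Qed.

Lemma integrable_euler_real (x : R) : 0 < x ->
  mu.-integrable D (EFin \o euler_integrand 1 x%:C).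
Proof.
move=> x0.
have f0 t : 0 < t -> 0 <= euler_integrand 1 x%:C t.
  by move=> t0; rewrite euler_integrand_real mulr_ge0 ?expR_ge0 ?powR_ge0.
have g0 n t : 0 < t -> 0 <= euler_trunc 1 x%:C n t.
  have e1 : x%:C - 1 = (x - 1)%:C by rewrite rmorphB rmorph1.
  have h : 0 <= complex.Re (1 * cpowR t (x%:C - 1)).
    by rewrite mul1r e1 cpowR_real powR_ge0.
  move=> t0; rewrite /euler_trunc patchE; case: ifPn => // /[!inE] /=.
  rewrite in_itv /= => /andP[nt tn].
  have n0' : 0 < n%:R :> R by rewrite (lt_le_trans t0).
  rewrite mulr_ge0 ?exprn_ge0 //.
  by rewrite subr_ge0 ler_pdivrMr // mul1r.
pose F := euler_integrand 1 x%:C; pose G n t := euler_trunc 1 x%:C n t.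
apply/integrableP; split.
  by apply/measurable_EFinP; exact: measurable_euler_integrand.
(* The shift by 2 makes the index exceed 1, so that [[1/n, n]] is a nondegenerate interval. *)
have -> : (\int[mu]_(t in D) `|(EFin \o F) t| =
   \int[mu]_(t in D) limn_einf (fun n => (G (n + 2)%N t)%:E))%E.
  apply: eq_integral => t; rewrite inE in_D => t0 /=.
  rewrite ger0_norm ?f0 //; apply/esym.
  have /cvg_limn_einf_sup[-> _] //: (G (n + 2)%N t)%:E @[n --> \oo] -->
     (F t)%:E.
  apply: cvg_EFin; first exact: nearW.
  by rewrite (cvg_shiftn 2 (fun n => G n t)); exact: euler_trunc_cvg.
apply: le_lt_trans (fatou _ _ _ _) _ => //.
- by move=> n; apply/measurable_EFinP; exact: measurable_euler_trunc.
- by move=> n t; rewrite in_D lee_fin => t0; exact: g0.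
(* The first summand bounds Gauss's product (upper end [n]), the second the primitive at the lower
   end [1/n], where [(1/n)^x <= 1]. *)
pose M := (1 + x) `^ x / x + expR 1 / x.
apply: (@le_lt_trans _ _ M%:E); last exact: ltry.
apply: le_trans (limn_einf_sup _) _; rewrite limn_esup_lim.
apply: lime_le; first exact: is_cvg_esups.
apply: nearW => n; apply: ge_ereal_sup => _ [k /= nk <-].
rewrite integral_euler_trunc_gauss ?addn2 // lee_fin !mul1r gauss_real /=.
have p0 : (0 < k.+2)%N by [].
have := @euler_prim_inv_le R 1 x%:C k.+2 p0 x0; rewrite !mul1r Normc.normc1 mul1r /=.
rewrite ler_norml => /andP[h _]; rewrite lerD ?gaussR_le //.
rewrite lerNl; apply: le_trans h; rewrite lerN2 -[leRHS]mulr1 ler_wpM2l //.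
  by rewrite divr_ge0 ?expR_ge0 // ltW.
apply: (@le_trans _ _ (1 `^ x)); last by rewrite powR1.
apply: ge0_ler_powR; rewrite ?nnegrE ?(ltW x0) ?invr_ge0 //.
by rewrite invf_le1 ?ltr0n // ler1n.
Qed.

Definition gamma_part a z : R := \int[mu]_(t in D) euler_integrand a z t.

Lemma gauss_cvg_part a z : 0 < complex.Re z ->
  complex.Re (a * gauss z n) @[n --> \oo] --> gamma_part a z.
Proof.
move=> z0.
pose g t := Normc.normc a * euler_integrand 1 (complex.Re z)%:C t.
have ig : mu.-integrable D (EFin \o g).
  have := integrable_euler_real z0 => /(integrableZl _ (Normc.normc a)); exact.
have [||||| h0 _ h] := @dominated_convergence _ _ _ mu D _
   (fun n t => (euler_trunc a z n t)%:E) (EFin \o euler_integrand a z) (EFin \o g) _ _ _ ig _.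
- by [].
- by move=> n; apply/measurable_EFinP; exact: measurable_euler_trunc.
- by apply/measurable_EFinP; exact: measurable_euler_integrand.
- apply: aeW => t; rewrite in_D => t0.
  apply: cvg_EFin; first exact: nearW.
  exact: euler_trunc_cvg.
- apply: aeW => t n; rewrite in_D => t0; rewrite /= lee_fin; exact: euler_trunc_le.
have {}h : fine (\int[mu]_(t in D) (euler_trunc a z n t)%:E)%E @[n --> \oo] -->
    gamma_part a z.
  by apply: fine_cvg; rewrite fineK; [exact: h|exact: integrable_fin_num].
have h3 : (fine (\int[mu]_(t in D) (euler_trunc a z n t)%:E)%E +
    complex.Re (a * euler_prim z n n%:R^-1) : R) @[n --> \oo] --> gamma_part a z.
  rewrite -[gamma_part a z]addr0; exact: cvgD h (euler_prim_inv_cvg a z0).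
apply: cvg_trans h3; apply: near_eq_cvg; near=> n.
rewrite integral_euler_trunc_gauss //=; last by near: n; exists 2%N.
by rewrite subrK.
Unshelve. all: by end_near. Qed.

Lemma normc_lt (z : R[i]) (e : R) :
  `|complex.Re z| < e / 2 -> `|complex.Im z| < e / 2 -> Normc.normc z < e.
Proof.
case: z => [x y] /= h1 h2.
have e2 : 0 < e / 2 by apply: le_lt_trans h1.
have e0 : 0 < e by lra.
rewrite -[e]gtr0_norm // -sqrtr_sqr ltr_sqrt ?exprn_gt0 //.
have : `|x| ^+ 2 < (e / 2) ^+ 2 by rewrite ltrXn2r ?nnegrE.
have : `|y| ^+ 2 < (e / 2) ^+ 2 by rewrite ltrXn2r ?nnegrE.
rewrite !real_normK ?num_real // => hx hy.
have : 0 < e ^+ 2 by rewrite exprn_gt0.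
lra.
Qed.

Lemma cvg_complex (T : Type) (F : set_system T) {FF : Filter F} (u : T -> R[i]) (l : R[i]) :
  complex.Re (u x) @[x --> F] --> complex.Re l ->
  complex.Im (u x) @[x --> F] --> complex.Im l ->
  (u x : R[i]^o) @[x --> F] --> (l : R[i]^o).
Proof.
move=> /cvgrPdist_lt hr /cvgrPdist_lt hi.
(* The norm of [R[i]] takes values in [R[i]], so the radius is complex; its positivity forces its
   imaginary part to be 0. *)
apply/cvgrPdist_lt => e; case: e => e e'; rewrite ltcE /= => /andP[/eqP -> e0].
have e2 : 0 < e / 2 by rewrite divr_gt0.
near=> x; rewrite normcR -[e +i* 0]/(e%:C) ltcR.
apply: normc_lt; rewrite ?cReB ?cImB; near: x; [exact: hr|exact: hi].
Unshelve. all: by end_near. Qed.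

Lemma gauss_cvg_Gamma_int z : 0 < complex.Re z ->
  (gauss z n : R[i]^o) @[n --> \oo] --> (Gamma_int z : R[i]^o).
Proof.
move=> z0.
have -> : Gamma_int z = gamma_part 1 z +i* gamma_part (- 'i%C) z.
  rewrite /Gamma_int; congr (_ +i* _); apply: eq_Rintegral => t _.
    by rewrite /euler_integrand mul1r cReMr.
  by rewrite cImE mulrA cReMr.
apply: cvg_complex => /=.
  have := @gauss_cvg_part 1 z z0.
  by under eq_fun do rewrite mul1r.
have := @gauss_cvg_part (- 'i%C) z z0.
by under eq_fun do rewrite -cImE.
Qed.

End GammaLimit.

(** * Gamma as the limit of Gauss's product, and its nonvanishing *)

Section GammaGauss.
Variable R : realType.
Implicit Types (z w : R[i]).

Lemma Gamma_int_neq0 z : 0 < complex.Re z -> Gamma_int z != 0.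
Proof.
move=> z0; apply/eqP => h; have := gauss_cvg_Gamma_int z0; rewrite h.
have := @normc_gauss_ge R z; set c := _ * _ => hc.
have c0 : 0 < c.
  by rewrite mulr_gt0 ?expR_gt0 // invr_gt0 mulr_gt0 // addr_gt0.
have cC0 : 0 < c%:C by rewrite ltcR.
move=> /cvgrPdist_lt /(_ _ cC0) [N _ hN].
have := hN N.+1 (leqnSn N); rewrite /= sub0r normrN normcR ltcR => h2.
by have := le_lt_trans (hc N.+1 z0 isT) h2; rewrite ltxx.
Qed.

Lemma shift_div_cvg1 z : ((z + n.+1%:R) / n%:R : R[i]^o) @[n --> \oo] --> (1 : R[i]^o).
Proof.
have h : (1 + (z + 1) * (n%:R^-1)%:C : R[i]^o) @[n --> \oo] --> (1 : R[i]^o).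
  rewrite -[X in _ --> X]addr0 -[X in _ --> _ + X](mulr0 (z + 1)).
  apply: cvgD; first exact: cvg_cst.
  apply: cvgMr; apply: cvg_complex => /=; first exact: invn_cvg0.
  exact: cvg_cst.
apply: cvg_trans h; apply: near_eq_cvg; near=> n.
have nn : n%:R != 0 :> R[i] by rewrite pnatr_eq0 -lt0n; near: n; exists 1%N.
rewrite fmorphV rmorph_nat -natr1.
by field.
Unshelve. all: by end_near. Qed.

(** Carries the limit from the half-plane of Euler's integral back by [N] applications of
    [gauss_shift], dividing by the same factors as the definition of [Gamma]. *)
Lemma gauss_cvg_shift z N (L : R[i]) : (forall i : nat, z + i%:R != 0) ->
  (gauss (z + N%:R) n : R[i]^o) @[n --> \oo] --> (L : R[i]^o) ->
  (gauss z n : R[i]^o) @[n --> \oo] --> (L / \prod_(i < N) (z + i%:R) : R[i]^o).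
Proof.
elim: N z => [|N IH] z hz; first by rewrite big_ord0 invr1 mulr1 addr0.
have hz1 i : z + 1 + i%:R != 0 by rewrite -addrA nat1r.
rewrite -nat1r addrA => /(IH _ hz1) h.
have -> : L / \prod_(i < N.+1) (z + i%:R) = L / \prod_(i < N) (z + 1 + i%:R) * 1 / z.
  rewrite big_ord_recl addr0 invfM mulr1 mulrA mulrAC; congr (_ / _ / _).
  by apply: eq_bigr => i _; rewrite -addrA nat1r.
have h3 : (gauss (z + 1) n * ((z + n.+1%:R) / n%:R) / z : R[i]^o) @[n --> \oo] -->
    (L / \prod_(i < N) (z + 1 + i%:R) * 1 / z : R[i]^o).
  exact: @cvgMr_tmp _ _ _ _ _ _ z^-1 (cvgM h (shift_div_cvg1 z)).
apply: cvg_trans h3; apply: near_eq_cvg; near=> n.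
have n0 : (0 < n)%N by near: n; exists 1%N.
have z0 : z != 0 by have := hz 0%N; rewrite addr0.
by rewrite (gauss_shift n0 z0 (hz n.+1)).
Unshelve. all: by end_near. Qed.

Lemma gauss_cvg_Gamma z : (forall i : nat, z + i%:R != 0) ->
  (gauss z n : R[i]^o) @[n --> \oo] --> (Gamma z : R[i]^o).
Proof.
move=> hz; rewrite /Gamma; case: ifPn => [z0|].
  by rewrite big_ord0 invr1 mulr1 addr0; exact: gauss_cvg_Gamma_int.
rewrite -leNgt => z0; apply: gauss_cvg_shift => //.
apply: gauss_cvg_Gamma_int; rewrite cReD natC /=.
by rewrite -ltrBlDl sub0r truncnS_gt.
Qed.

Lemma Gamma_neq0 z : (forall i : nat, z + i%:R != 0) -> Gamma z != 0.
Proof.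
move=> hz; rewrite /Gamma mulf_neq0 ?invr_eq0 //.
  apply: Gamma_int_neq0; case: ifPn => [z0|]; first by rewrite addr0.
  rewrite -leNgt => z0; rewrite cReD natC /=.
  by rewrite -ltrBlDl sub0r truncnS_gt.
by apply/prodf_neq0 => i _.
Qed.

End GammaGauss.

(** * Factorial moments of the hypergeometric law *)

Lemma stirling1_small j i : (j < i)%N -> stirling1 j i = 0%N.
Proof.
elim: j i => [|j IH] [|i] //= h.
by rewrite !IH ?muln0 // ltnW.
Qed.

Lemma stirling2_small j i : (j < i)%N -> stirling2 j i = 0%N.
Proof.
elim: j i => [|j IH] [|i] //= h.
by rewrite !IH ?muln0 // ltnW.
Qed.

Lemma stirling1_diag j : stirling1 j j = 1%N.
Proof. by elim: j => //= j ->; rewrite stirling1_small // muln0. Qed.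

Lemma stirling2_diag j : stirling2 j j = 1%N.
Proof. by elim: j => //= j ->; rewrite stirling2_small // muln0. Qed.

Lemma expn_stirling2 (n l : nat) :
  (n ^ l)%N = (\sum_(r < l.+1) stirling2 l r * n ^_ r)%N.
Proof.
elim: l => [|l IH]; first by rewrite big_ord1.
rewrite expnS IH big_distrr [RHS]big_ord_recl /= add0n.
under [RHS]eq_bigr => r _ do rewrite /bump /= add1n mulnDl.
rewrite big_split /=.
rewrite [X in _ = (X + _)%N]big_ord_recr /= stirling2_small // muln0 mul0n addn0.
have -> : (\sum_(i < l) i.+1 * stirling2 l i.+1 * n ^_ i.+1 =
           \sum_(i < l.+1) i * stirling2 l i * n ^_ i)%N.
  by rewrite big_ord_recl.
rewrite -big_split /=; apply: eq_bigr => r _.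
have [rn|nr] := leqP r n.
  rewrite ffactnSr -{1}(subnKC rn); ring.
by rewrite !ffact_small ?muln0 // ltnW.
Qed.

Lemma ffact_stirling1 (R : comNzRingType) (w j : nat) :
  (w ^_ j)%:R = \sum_(i < j.+1) (-1) ^+ (j - i) * (stirling1 j i)%:R * w%:R ^+ i :> R.
Proof.
pose a j i : R := (-1) ^+ (j - i) * (stirling1 j i)%:R.
rewrite -[RHS]/(\sum_(i < j.+1) a j i * w%:R ^+ i).
(* The signed Stirling numbers obey the recursion that multiplication by [w - k] induces on
   coefficients. *)
have aS k i : (i <= k)%N -> a k.+1 i.+1 = a k i - k%:R * a k i.+1.
  rewrite /a subSS leq_eqVlt => /predU1P[->|ik].
    by rewrite /= stirling1_small // muln0 add0n !mulr0 subr0.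
  by rewrite -[(k - i)%N]subnSK // natrD natrM exprS /=; ring.
have a0 k : k%:R * a k 0%N = 0 :> R.
  by case: k => [|k]; rewrite ?mul0r // /a /= !mulr0.
elim: j => [|j IH]; first by rewrite big_ord1 /a !mulr1.
have -> : (w ^_ j.+1)%:R = (w ^_ j)%:R * (w%:R - j%:R) :> R.
  have [jw|wj] := leqP j w; first by rewrite ffactnSr natrM natrB.
  by rewrite !ffact_small ?mul0r // ltnW.
rewrite mulrBr IH [RHS]big_ord_recl /=.
have -> : a j.+1 0%N = 0 by rewrite /a /= mulr0.
rewrite mul0r add0r.
have -> : \sum_(i < j.+1) a j.+1 (bump 0 i) * w%:R ^+ bump 0 i =
  (\sum_(i < j.+1) a j i * w%:R ^+ i) * w%:R -
  \sum_(i < j.+1) a j i.+1 * w%:R ^+ i.+1 * j%:R.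
  rewrite mulr_suml -sumrB; apply: eq_bigr => i _.
  by rewrite /bump add1n aS -1?ltnS // exprSr; ring.
congr (_ - _); rewrite -mulr_suml.
rewrite [in LHS]big_ord_recl [in RHS]big_ord_recr /= mulrDl !expr0 mulr1.
rewrite [a j 0%N * _]mulrC a0 add0r.
have -> : a j j.+1 = 0 by rewrite /a stirling1_small // mulr0.
by rewrite mul0r addr0.
Qed.

Lemma bin_mul_ffact w r i : ('C(w, r + i) * (r + i) ^_ r = w ^_ r * 'C(w - r, i))%N.
Proof.
elim: r w => [|r IH] w; first by rewrite !ffactn0 subn0 muln1 mul1n.
rewrite addSn !ffactnS /= mulnA [('C(_, _) * _)%N]mulnC -mul_bin_diag -!mulnA.
by rewrite IH -subn1 -subnDA add1n.
Qed.

(** Absorbing [j ^_ r] into ['C(w, j)] leaves [w ^_ r] times a Vandermonde sum equal to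
    ['C(t - r, m - r)]; the ratio to ['C(t, m)] is then rewritten by the same absorption. *)
Lemma hypergeom_ffact (R : realType) (w t m r : nat) : (w <= t)%N -> (m <= t)%N ->
  \sum_(j < m.+1) hypergeom R m w t j * (j ^_ r)%:R =
  (w ^_ r)%:R * ('C(m, r)%:R / 'C(t, r)%:R).
Proof.
move=> wt mt.
(* For [r > m] or [r > w] both sides vanish; otherwise the truncated subtractions [m - r] and
   [w - r] are exact. *)
have [mr|rm] := ltnP m r.
  rewrite bin_small // mul0r mulr0; apply: big1 => j _.
  by rewrite ffact_small ?mulr0 // (leq_ltn_trans _ mr) // -ltnS.
have [wr|rw] := ltnP w r.
  rewrite ffact_small // mul0r; apply: big1 => j _; rewrite /hypergeom.
  have [jr|rj] := ltnP j r; first by rewrite ffact_small // mulr0.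
  by rewrite bin_small ?mul0n ?mul0r // (leq_trans wr).
have tr : (r <= t)%N := leq_trans rm mt.
have key : (\sum_(j < m.+1) 'C(w, j) * 'C(t - w, m - j) * j ^_ r =
    w ^_ r * 'C(t - r, m - r))%N.
  rewrite -(big_mkord xpredT (fun j => 'C(w, j) * 'C(t - w, m - j) * j ^_ r)%N).
  rewrite (@big_cat_nat _ _ _ r) //=; last exact: leqW.
  rewrite big_nat_cond big1 ?add0n; last first.
    by move=> j /andP[/andP[_ jr] _]; rewrite ffact_small ?muln0.
  rewrite -{1}(add0n r) big_addn subSn // big_mkord.
  have -> : (t - r = (w - r) + (t - w))%N by rewrite addnC addnBA // subnK.
  rewrite -binomial.Vandermonde big_distrr; apply: eq_bigr => j _ /=.
  by rewrite mulnAC addnC bin_mul_ffact subnDA mulnA.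
under eq_bigr => j _ do rewrite /hypergeom mulrAC -natrM.
rewrite -mulr_suml -natr_sum key natrM -mulrA; congr (_ * _).
have b0 : 'C(t, m)%:R != 0 :> R by rewrite pnatr_eq0 -lt0n bin_gt0.
have b1 : 'C(t, r)%:R != 0 :> R by rewrite pnatr_eq0 -lt0n bin_gt0.
apply/eqP; rewrite eqr_div // -!natrM; apply/eqP; congr (_%:R).
have := bin_mul_ffact t r (m - r); rewrite subnKC // -!bin_ffact.
move=> h; apply/eqP; rewrite -(eqn_pmul2r (fact_gt0 r)); apply/eqP.
transitivity ('C(t, r) * r`! * 'C(t - r, m - r))%N; first by ring.
by rewrite -h; ring.
Qed.

Lemma expn_stirling (R : comNzRingType) (n l : nat) :
  (n%:R ^+ l : R) = \sum_(r < l.+1) (stirling2 l r)%:R * (n ^_ r)%:R.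
Proof.
by rewrite -natrX expn_stirling2 natr_sum; apply: eq_bigr => r _; rewrite natrM.
Qed.

(** A summation range independent of [j] allows the sums to be interchanged; the added Stirling
    numbers are 0. *)
Lemma ffact_stirling1_widen (R : comNzRingType) (w j L : nat) : (j < L)%N ->
  (w ^_ j)%:R = \sum_(0 <= i < L) (-1) ^+ (j - i) * (stirling1 j i)%:R * w%:R ^+ i :> R.
Proof.
move=> jL; rewrite ffact_stirling1 (@big_cat_nat _ _ _ j.+1) //= big_mkord.
rewrite [X in _ + X]big_nat_cond [X in _ + X]big1 ?addr0 //.
by move=> i /andP[/andP[ji _] _]; rewrite stirling1_small // mulr0 mul0r.
Qed.

Lemma sum_triangle (V : nmodType) (s : nat) (F : nat -> nat -> V) :
  \sum_(0 <= l < s.+1) \sum_(2 <= i < l.+1) F l i =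
  \sum_(2 <= i < s.+1) \sum_(i <= l < s.+1) F l i.
Proof.
transitivity (\sum_(0 <= l < s.+1) \sum_(2 <= i < s.+1 | (i < l.+1)%N) F l i).
  by apply: eq_big_nat => l /andP[_ ls]; rewrite (big_nat_widen _ _ s.+1).
rewrite (exchange_big_dep_nat xpredT) //=.
apply: eq_big_nat => i /andP[i2 _]; by rewrite [RHS](big_nat_widenl _ 0%N).
Qed.

Section HypergeomMoment.
Variables (R : realType) (w t m c s : nat).
Hypotheses (wt : (w <= t)%N) (mt : (m <= t)%N).

(** The coefficient of [w^q] in the [l]-th moment of the hypergeometric law. *)
Definition stirling_coef (l q : nat) : R :=
  \sum_(q <= j < l.+1) (-1) ^+ (j - q) *
    (stirling2 l j * stirling1 j q * 'C(m, j))%:R / 'C(t, j)%:R.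

Lemma hypergeom_power (l : nat) :
  \sum_(j < m.+1) hypergeom R m w t j * j%:R ^+ l =
  \sum_(0 <= q < l.+1) w%:R ^+ q * stirling_coef l q.
Proof.
under eq_bigr => j _ do rewrite expn_stirling mulr_sumr.
rewrite exchange_big /=.
under eq_bigr => r _.
  under eq_bigr => j _ do rewrite mulrCA.
  rewrite -mulr_sumr hypergeom_ffact // (@ffact_stirling1_widen _ _ _ l.+1) //.
  rewrite mulr_suml mulr_sumr.
  over.
rewrite exchange_big /=; apply: eq_big_nat => q /andP[_ ql].
rewrite mulr_sumr -(big_mkord xpredT (fun r => (stirling2 l r)%:R *
  ((-1) ^+ (r - q) * (stirling1 r q)%:R * w%:R ^+ q * ('C(m, r)%:R / 'C(t, r)%:R)))).
rewrite (@big_cat_nat _ _ _ q) //=; last exact: ltnW.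
rewrite big_nat_cond big1 ?add0r; last first.
  by move=> r /andP[/andP[_ rq] _]; rewrite stirling1_small // mulr0 !mul0r mulr0.
by apply: eq_bigr => r _; rewrite !natrM; ring.
Qed.

Lemma stirling_coef_diag l : stirling_coef l l = 'C(m, l)%:R / 'C(t, l)%:R.
Proof.
by rewrite /stirling_coef big_nat1 subnn expr0 stirling1_diag stirling2_diag !mul1n mul1r.
Qed.

(** Positive moments have no constant term in [w]; hence the index [i] of [beta], with
    [q = l + 1 - i], stops at [l]. *)
Lemma stirling_coef0 l : stirling_coef l.+1 0 = 0.
Proof.
rewrite /stirling_coef; apply: big1 => -[|j] _ /=.
  by rewrite !mul0n mulr0 mul0r.
by rewrite muln0 mul0n mulr0 mul0r.
Qed.

(** With [q = l + 1 - i], the top power [q = l] gives the part proportional to [w^s], which goes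
    into [alpha]; [q = 0] vanishes, and the others are the part of [beta]. *)
Lemma hypergeom_power_scaled l : (l <= s)%N ->
  w%:R ^+ (s - l) * (\sum_(j < m.+1) hypergeom R m w t j * j%:R ^+ l) =
  'C(m, l)%:R / 'C(t, l)%:R * w%:R ^+ s +
  \sum_(2 <= i < l.+1) w%:R ^+ (s + 1 - i) * stirling_coef l (l + 1 - i).
Proof.
move=> ls; rewrite hypergeom_power -stirling_coef_diag; case: l ls => [|l] ls.
  by rewrite big_nat1 big_geq // mul1r addr0 subn0 mulrC.
rewrite big_nat_recr //= big_nat_recl //= stirling_coef0 mulr0 add0r mulrDr addrC.
congr (_ + _); first by rewrite mulrA -exprD subnK // mulrC.
rewrite [RHS]big_add1 /= big_add1 /= big_nat_rev /= mulr_sumr.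
apply: eq_big_nat => i /andP[_ il].
rewrite mulrA -exprD add0n; congr (_ ^+ _ * stirling_coef _ _); lia.
Qed.

(** The binomial theorem for [(w + c j)^s], with the terms regrouped by the power of [w] they carry
    instead of by [l]. *)
Lemma hypergeom_moment :
  \sum_(j < m.+1) hypergeom R m w t j * (w + c * j)%:R ^+ s =
  (\sum_(l < s.+1) c%:R ^+ l * ('C(s, l) * 'C(m, l))%:R / 'C(t, l)%:R) * w%:R ^+ s +
  \sum_(2 <= i < s.+1) w%:R ^+ (s + 1 - i) *
    \sum_(i <= l < s.+1) 'C(s, l)%:R * c%:R ^+ l *
      \sum_(l + 1 - i <= j < l.+1) (-1) ^+ (j + i - 1 - l) *
        (stirling2 l j * stirling1 j (l + 1 - i) * 'C(m, j))%:R / 'C(t, j)%:R.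
Proof.
under eq_bigr => j _ do rewrite natrD natrM exprDn mulr_sumr.
rewrite exchange_big /=.
transitivity (\sum_(0 <= l < s.+1) 'C(s, l)%:R * c%:R ^+ l * (w%:R ^+ (s - l) *
   (\sum_(j < m.+1) hypergeom R m w t j * j%:R ^+ l))).
  rewrite big_mkord; apply: eq_bigr => l _; rewrite !mulr_sumr; apply: eq_bigr => j _.
  by rewrite -mulr_natr exprMn; ring.
rewrite (eq_big_nat _ _ (F2 := fun l => 'C(s, l)%:R * c%:R ^+ l *
    ('C(m, l)%:R / 'C(t, l)%:R * w%:R ^+ s) + 'C(s, l)%:R * c%:R ^+ l *
    \sum_(2 <= i < l.+1) w%:R ^+ (s + 1 - i) * stirling_coef l (l + 1 - i))); last first.
  by move=> l /andP[_ ls]; rewrite -mulrDr -hypergeom_power_scaled.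
rewrite big_split /=; congr (_ + _).
  rewrite big_mkord mulr_suml; apply: eq_bigr => l _.
  by rewrite natrM; ring.
under eq_bigr => l _ do rewrite mulr_sumr.
rewrite sum_triangle; apply: eq_big_nat => i /andP[i2 _].
rewrite mulr_sumr; apply: eq_big_nat => l /andP[il _].
rewrite mulrCA; congr (_ * (_ * _)); apply: eq_big_nat => j /andP[lj _].
by congr (_ ^+ _ * _ / _); lia.
Qed.

End HypergeomMoment.

(** * The moment recursion *)

Section UrnMoments.
Variables (R : realType) (d : measure_display) (Om : measurableType d).
Variables (P : probability Om R) (m c W0 B0 : nat) (K : nat -> Om -> 'I_m.+1).
Hypothesis mT : (m <= W0 + B0)%N.
Hypothesis urnP : urn_process P c W0 B0 K.

Let cyl (n : nat) (k : nat -> 'I_m.+1) : set Om :=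
  [set x | forall i, (i < n)%N -> K i x = k i].

(** Turns a history of [n] draws into a function on all of [nat], the form used by [urn_law].
    Positions from [n] on carry [j], so the same function also describes the history continued by
    the draw [j]. *)
Let ext (n : nat) (h : {ffun 'I_n -> 'I_m.+1}) (j : 'I_m.+1) (i : nat) : 'I_m.+1 :=
  oapp h j (insub i).

Let ext_ord n (h : {ffun 'I_n -> 'I_m.+1}) j (i : 'I_n) : ext h j i = h i.
Proof. by rewrite /ext valK. Qed.

Let ext_last n (h : {ffun 'I_n -> 'I_m.+1}) j : ext h j n = j.
Proof. by rewrite /ext insubN // ltnn. Qed.

Let measurable_cyl n k : measurable (cyl n k).
Proof.
elim: n => [|n IH].
  by rewrite (_ : cyl 0 k = setT) //; apply/seteqP; split.
rewrite (_ : cyl n.+1 k = cyl n k `&` [set x | K n x = k n]).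
  by apply: measurableI => //; exact: (urn_measurable urnP).
apply/seteqP; split => x /=.
  by move=> h; split => [i ni|]; apply: h => //; exact: leqW.
move=> [h1 h2] i; rewrite ltnS leq_eqVlt => /predU1P[->//|]; exact: h1.
Qed.

(** Used with one set per history, of which there are finitely many. Nonnegative coefficients let
    the integral be taken termwise. *)
Lemma expectation_simple (I : finType) (A : I -> set Om) (F : I -> R) (X : Om -> R) :
  (forall i, measurable (A i)) -> (forall i, 0 <= F i) ->
  (forall x, X x = \sum_i F i * \1_(A i) x) ->
  fine ('E_P[X])%E = \sum_i F i * fine (P (A i)).
Proof.
move=> mA F0 XE; rewrite unlock.
have -> : (\int[P]_x (X x)%:E = \int[P]_x \sum_i (F i * \1_(A i) x)%:E)%E.
  by apply: eq_integral => x _; rewrite XE sumEFin.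
rewrite ge0_integral_sum //; last 2 first.
- by move=> i; apply/measurable_EFinP; apply: measurable_funM => //.
- by move=> i x _; rewrite lee_fin mulr_ge0.
rewrite -[RHS]/(fine (\sum_i F i * fine (P (A i)))%:E) -sumEFin; congr fine.
apply: eq_bigr => i _; under eq_integral => x _ do rewrite EFinM.
rewrite ge0_integralZl_EFin //; last by apply/measurable_EFinP.
by rewrite integral_indic // setIT EFinM fineK ?fin_num_measure.
Qed.

Lemma indic_hist n (h : {ffun 'I_n -> 'I_m.+1}) j x :
  \1_(cyl n (ext h j)) x = (h == [ffun i : 'I_n => K i x])%:R :> R.
Proof.
rewrite indicE; congr (_%:R : R); congr nat_of_bool.
apply/idP/eqP => [|->]; rewrite inE /cyl /=.
  by move=> hx; apply/ffunP => i; rewrite ffunE -(ext_ord h j) hx.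
by move=> i ni; have := ext_ord [ffun i : 'I_n => K i x] j (Ordinal ni); rewrite ffunE.
Qed.

Let whist n (h : {ffun 'I_n -> 'I_m.+1}) : nat := (W0 + c * \sum_(i < n) h i)%N.

Lemma moment_hist n r : moment P c W0 K n r =
  \sum_(h : {ffun 'I_n -> 'I_m.+1}) (whist h)%:R ^+ r * fine (P (cyl n (ext h ord0))).
Proof.
apply: expectation_simple.
- by move=> h; exact: measurable_cyl.
- by move=> h; exact: exprn_ge0.
- move=> x; under eq_bigr => h _ do rewrite indic_hist.
  rewrite (bigD1 [ffun i : 'I_n => K i x]) //= eqxx mulr1 big1 ?addr0; last first.
    by move=> h /negbTE ->; rewrite mulr0.
  rewrite /white /whist; congr ((_ + _ * _)%N%:R ^+ _).
  by apply: eq_bigr => i _; rewrite ffunE.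
Qed.

Let cyl_next n (h : {ffun 'I_n -> 'I_m.+1}) (j : 'I_m.+1) :
  fine (P (cyl n.+1 (ext h j))) =
  fine (P (cyl n (ext h ord0))) * hypergeom R m (whist h) (Defs.total m c W0 B0 n) j.
Proof.
have := urn_law urnP n (ext h j); rewrite -/(cyl _ _) => ->.
rewrite -/(cyl n (ext h j)).
have -> : cyl n (ext h j) = cyl n (ext h ord0).
  apply/seteqP; split => x /= hx i ni; rewrite hx //;
  by rewrite (ext_ord h _ (Ordinal ni)) (ext_ord h _ (Ordinal ni)).
rewrite fineM ?fin_num_measure //= ext_last; congr (_ * hypergeom _ _ _ _ _).
rewrite /whist; congr (_ + _ * _)%N; apply: eq_bigr => i _; by rewrite ext_ord.
Qed.

Lemma moment_next n r : moment P c W0 K n.+1 r =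
  \sum_(h : {ffun 'I_n -> 'I_m.+1}) fine (P (cyl n (ext h ord0))) *
    \sum_(j < m.+1) hypergeom R m (whist h) (Defs.total m c W0 B0 n) j *
      (whist h + c * j)%:R ^+ r.
Proof.
(* Histories of length [n + 1] are indexed by a shorter history and a last draw, so that the last
   draw can be summed by itself. *)
have -> : moment P c W0 K n.+1 r = \sum_(p : {ffun 'I_n -> 'I_m.+1} * 'I_m.+1)
   (whist p.1 + c * p.2)%:R ^+ r * fine (P (cyl n.+1 (ext p.1 p.2))).
  apply: expectation_simple.
  - by move=> h; exact: measurable_cyl.
  - by move=> h; exact: exprn_ge0.
  - move=> x; pose h0 := [ffun i : 'I_n => K i x].
    have e p : \1_(cyl n.+1 (ext p.1 p.2)) x = (p == (h0, K n x))%:R :> R.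
      rewrite indicE; congr (_%:R : R); congr nat_of_bool.
      apply/idP/eqP => [|->]; rewrite inE /cyl /=.
        case: p => h j /= hx; congr (_, _).
          apply/ffunP => i; rewrite ffunE -(ext_ord h j) hx //.
          by rewrite ltnS ltnW.
        by rewrite hx ?ext_last.
      move=> i; rewrite ltnS leq_eqVlt => /predU1P[->|ni]; first by rewrite ext_last.
      by have := ext_ord h0 (K n x) (Ordinal ni); rewrite ffunE.
    under eq_bigr => h _ do rewrite e.
    rewrite (bigD1 (h0, K n x)) //= eqxx mulr1 big1 ?addr0; last first.
      by move=> h /negbTE ->; rewrite mulr0.
    rewrite /white /whist big_ord_recr mulnDr addnA /=.
    congr ((_ + _ * _ + _)%N%:R ^+ _).
    by apply: eq_bigr => i _; rewrite ffunE.
rewrite -(pair_bigA _ (fun (h : {ffun 'I_n -> 'I_m.+1}) (j : 'I_m.+1) => (whist h + c * j)%:R ^+ r *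
   fine (P (cyl n.+1 (ext h j))))) /=.
apply: eq_bigr => h _; rewrite mulr_sumr; apply: eq_bigr => j _.
by rewrite cyl_next; ring.
Qed.

Lemma whist_le n (h : {ffun 'I_n -> 'I_m.+1}) : (whist h <= Defs.total m c W0 B0 n)%N.
Proof.
rewrite /whist /Defs.total -addnA leq_add2l.
have h1 : (\sum_(i < n) h i <= n * m)%N.
  rewrite -[X in (_ <= X * _)%N]card_ord -sum_nat_const; apply: leq_sum => i _.
  by rewrite -ltnS.
by rewrite mulnC (leq_trans (leq_mul h1 (leqnn c))) // leq_addl.
Qed.

(** The total is deterministic, so the coefficients in [hypergeom_moment] are the same for all
    histories, and averaging only turns powers of the white count into moments. *)
Lemma moment_rec n s : moment P c W0 K n.+1 s =
  alpha R m c W0 B0 n s * moment P c W0 K n s + beta P c W0 B0 K n s.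
Proof.
have mt : (m <= Defs.total m c W0 B0 n)%N by rewrite (leq_trans mT) // leq_addr.
rewrite moment_next /beta.
under eq_bigr => h _ do rewrite hypergeom_moment ?whist_le // mulrDr.
rewrite big_split /=; congr (_ + _).
  rewrite moment_hist mulr_sumr; apply: eq_bigr => h _.
  by rewrite /alpha; ring.
under eq_bigr => h _ do rewrite mulr_sumr.
rewrite exchange_big; apply: eq_bigr => i _ /=.
rewrite moment_hist mulr_suml; apply: eq_bigr => h _.
by rewrite mulrCA mulrA.
Qed.

Lemma moment0 s : moment P c W0 K 0 s = W0%:R ^+ s.
Proof.
rewrite /moment (_ : (fun x => _) = cst (W0%:R ^+ s)) ?expectation_cst //.
by apply/funext => x; rewrite /white big_ord0 muln0 addn0.
Qed.

Lemma moment_ge0 n s : 0 <= moment P c W0 K n s.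
Proof.
rewrite moment_hist; apply: sumr_ge0 => h _.
by rewrite mulr_ge0 ?exprn_ge0 ?fine_ge0.
Qed.

Lemma moment_le n s : moment P c W0 K n s <= (Defs.total m c W0 B0 n)%:R ^+ s.
Proof.
rewrite moment_hist; apply: (@le_trans _ _
  (\sum_(h : {ffun 'I_n -> 'I_m.+1}) (Defs.total m c W0 B0 n)%:R ^+ s * fine (P (cyl n (ext h ord0))))).
  apply: ler_sum => h _; rewrite ler_wpM2r ?fine_ge0 //.
  by rewrite lerXn2r ?nnegrE // ler_nat whist_le.
rewrite -mulr_sumr ler_piMr ?exprn_ge0 //.
(* The weights of the histories add up to the moment of order 0, which is 1. *)
have := moment_hist n 0; under eq_bigr => h _ do rewrite expr0 mul1r.
move=> <-; rewrite /moment (_ : (fun x => _) = cst 1) ?expectation_cst //.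
Qed.

End UrnMoments.

(** * The product of the coefficients alpha *)

Section RealAlpha.
Variables (R : realType) (m c s : nat).
Implicit Types T h : R.

Lemma gbinom0 (F : fieldType) (y : F) : gbinom y 0 = 1.
Proof. by rewrite /gbinom big_ord0 fact0 divr1. Qed.

Lemma gbinom_nat (F : numFieldType) (n l : nat) : gbinom (n%:R : F) l = 'C(n, l)%:R.
Proof.
have f0 : l`!%:R != 0 :> F by rewrite pnatr_eq0 -lt0n fact_gt0.
apply: (mulIf f0); rewrite /gbinom divfK // -natrM bin_ffact.
elim: l {f0} => [|l IH]; first by rewrite big_ord0 ffactn0.
rewrite big_ord_recr /= IH; have [ln|nl] := leqP l n.
  by rewrite ffactnSr natrM natrB.
by rewrite !ffact_small ?mul0r // ltnW.
Qed.

(** [alpha] as a function of a real total, since shifting by [e] leaves the integers. *)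
Definition alpha_at T : R :=
  \sum_(l < s.+1) c%:R ^+ l * ('C(s, l) * 'C(m, l))%:R / gbinom T l.

Lemma falling_gt0 T l : (l <= m)%N -> m%:R - 1 < T -> 0 < \prod_(i < l) (T - i%:R).
Proof.
move=> lm Tm; apply: prodr_gt0 => i _.
have : (i.+1%:R : R) <= m%:R by rewrite ler_nat (leq_trans (ltn_ord i)).
by rewrite -natr1; lra.
Qed.

Lemma falling_le T h l : (l <= m)%N -> m%:R - 1 < T -> 0 <= h ->
  \prod_(i < l) (T - i%:R) <= \prod_(i < l) (T + h - i%:R).
Proof.
move=> lm Tm h0; apply: ler_prod => i _; apply/andP.
have : (i.+1%:R : R) <= m%:R by rewrite ler_nat (leq_trans (ltn_ord i)).
by rewrite -natr1; split; lra.
Qed.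

(** The margin 1/2 keeps every factor at least 1/2; it is what is left when a shift lowers the total
    by at most 1/2. *)
Lemma falling_inv_le T l : (l <= m)%N -> m%:R - 2^-1 <= T ->
  (\prod_(i < l) (T - i%:R))^-1 <= 2 ^+ l.
Proof.
move=> + Tm; elim: l => [|l IH] lm; first by rewrite big_ord0 invr1.
have Tl : 2^-1 <= T - l%:R.
  have : (l.+1%:R : R) <= m%:R by rewrite ler_nat.
  by rewrite -natr1; lra.
have Tm1 : m%:R - 1 < T by lra.
rewrite big_ord_recr /= invfM exprSr ler_pM ?invr_ge0 //; last 2 first.
- exact: IH (ltnW lm).
- by rewrite -[leRHS]invrK lef_pV2 ?posrE //; lra.
- exact/ltW/falling_gt0/Tm1/ltnW.
- lra.
Qed.

(** By induction, as [p/a - q/(a+h) = (p-q)/a + q h/(a (a+h))] with [1/a <= 2]. The square in the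
    denominator is what makes the differences summable over time. *)
Lemma falling_inv_diff T h l : (l <= m)%N -> m%:R - 2^-1 <= T -> 0 <= h ->
  (\prod_(i < l) (T - i%:R))^-1 - (\prod_(i < l) (T + h - i%:R))^-1 <=
  l%:R * 2 ^+ l * h / (T - m%:R + 1) ^+ 2.
Proof.
move=> + Tm h0; elim: l => [|l IH] lm; first by rewrite !big_ord0 subrr !mul0r.
set D := T - m%:R + 1; have D0 : 0 < D by rewrite /D; lra.
have Tl : 2^-1 <= T - l%:R /\ D <= T - l%:R.
  have : (l.+1%:R : R) <= m%:R by rewrite ler_nat.
  by rewrite -natr1 /D; split; lra.
case: Tl => Tl DTl; have Tm1 : m%:R - 1 < T by lra.
have {}IH := IH (ltnW lm).
rewrite !big_ord_recr /= !invfM.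
set p := (\prod_(i < l) (T - i%:R))^-1; set q := (\prod_(i < l) (T + h - i%:R))^-1.
have q0 : 0 <= q by rewrite invr_ge0 ltW // falling_gt0 ?(ltnW lm) //; lra.
have q2 : q <= 2 ^+ l by apply: falling_inv_le; [exact: ltnW|lra].
set a := T - l%:R in Tl DTl *; have -> : T + h - l%:R = a + h by rewrite /a; ring.
have -> : p / a - q / (a + h) = (p - q) / a + q * (h / (a * (a + h))).
  by field; apply/andP; split; lra.
have e1 : (p - q) / a <= l%:R * 2 ^+ l * h / D ^+ 2 * 2.
  apply: (@le_trans _ _ (l%:R * 2 ^+ l * h / D ^+ 2 / a)).
    by rewrite ler_wpM2r // invr_ge0; lra.
  rewrite ler_wpM2l ?mulr_ge0 ?exprn_ge0 ?invr_ge0 ?exprn_ge0 ?(ltW D0) //.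
  by rewrite -[leRHS]invrK lef_pV2 ?posrE //; lra.
have e2 : q * (h / (a * (a + h))) <= 2 ^+ l * (h / D ^+ 2).
  apply: ler_pM => //; first by rewrite divr_ge0 // mulr_ge0 //; lra.
  rewrite ler_wpM2l // lef_pV2 ?posrE ?mulr_gt0 ?exprn_gt0 //; try lra.
  by rewrite expr2 ler_pM //; lra.
have D2 : 0 <= 2 ^+ l * (h / D ^+ 2).
  by rewrite mulr_ge0 ?divr_ge0 ?exprn_ge0 // ltW.
apply: le_trans (lerD e1 e2) _.
rewrite [leRHS](_ : _ = (l%:R + 1) * (2 ^+ l * (h / D ^+ 2)) * 2); last first.
  have E : 2 ^+ l.+1 = 2 * 2 ^+ l :> R by rewrite exprS.
  by rewrite E -[l.+1%:R]natr1 -invfM -expr2; ring.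
have -> : l%:R * 2 ^+ l * h / D ^+ 2 * 2 = l%:R * (2 ^+ l * (h / D ^+ 2)) * 2 by ring.
lra.
Qed.

Lemma alpha_at_ge1 T : m%:R - 1 < T -> 1 <= alpha_at T.
Proof.
move=> Tm; rewrite /alpha_at big_ord_recl gbinom0 !bin0 muln1 expr0 mul1r divr1 lerDl.
apply: sumr_ge0 => l _; have [lm|ml] := leqP (bump 0 l) m; last first.
  by rewrite (@bin_small m) // muln0 mulr0 mul0r.
rewrite mulr_ge0 ?mulr_ge0 ?exprn_ge0 ?invr_ge0 // /gbinom mulr_ge0 ?invr_ge0 //.
exact/ltW/falling_gt0.
Qed.

Lemma alpha_at_le T h : m%:R - 1 < T -> 0 <= h -> alpha_at (T + h) <= alpha_at T.
Proof.
move=> Tm h0; apply: ler_sum => l _; have [lm|ml] := leqP l m; last first.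
  by rewrite (@bin_small m) // muln0 mulr0 !mul0r.
rewrite ler_wpM2l ?mulr_ge0 ?exprn_ge0 // /gbinom !invf_div ler_wpM2l //.
have Thm : m%:R - 1 < T + h by rewrite (lt_le_trans Tm) // lerDl.
by rewrite lef_pV2 ?posrE ?falling_gt0 // falling_le.
Qed.

Definition alpha_lip : R :=
  \sum_(l < s.+1) c%:R ^+ l * ('C(s, l) * 'C(m, l))%:R * (l`!%:R * (l%:R * 2 ^+ l)).

Lemma alpha_at_diff T h : m%:R - 2^-1 <= T -> 0 <= h ->
  alpha_at T - alpha_at (T + h) <= alpha_lip * h / (T - m%:R + 1) ^+ 2.
Proof.
move=> Tm h0; rewrite /alpha_at /alpha_lip -sumrB 2!mulr_suml; apply: ler_sum => l _.
have [lm|ml] := leqP l m; last first.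
  by rewrite (@bin_small m) // muln0 mulr0 !mul0r subr0.
rewrite -mulrBr -!mulrA 2?ler_wpM2l ?exprn_ge0 //.
rewrite /gbinom !invf_div -mulrBr ler_wpM2l // !mulrA.
exact: falling_inv_diff.
Qed.

End RealAlpha.

Section AlphaProducts.
Variables (R : realType) (m c W0 B0 : nat).
Hypotheses (m2 : (2 <= m)%N) (c1 : (1 <= c)%N) (mT : (m <= W0 + B0)%N).

Let T0 : R := (W0 + B0)%:R.
Let mc : R := (m * c)%:R.

Definition shifted_total (j : nat) (e : R) : R := T0 + (j%:R + e) * mc.

Definition alpha_prod (s n : nat) (e : R) : R :=
  \prod_(j < n) alpha_at m c s (shifted_total j e).

Lemma mc_gt0 : 0 < mc.
Proof. by rewrite /mc ltr0n muln_gt0 c1 andbT (ltn_trans _ m2). Qed.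

Lemma alpha_alpha_at j s : alpha R m c W0 B0 j s = alpha_at m c s (shifted_total j 0).
Proof.
rewrite /alpha /alpha_at; apply: eq_bigr => l _; congr (_ / _).
rewrite /shifted_total addr0 -gbinom_nat; congr (gbinom _ _).
by rewrite /Defs.total natrD -mulnA natrM.
Qed.

Lemma alpha_prodE s n : \prod_(0 <= j < n) alpha R m c W0 B0 j s = alpha_prod s n 0.
Proof. by rewrite big_mkord; apply: eq_bigr => j _; rewrite alpha_alpha_at. Qed.

(** The lower limit for [e] costs at most 1/2 of the total, and each draw adds [mc >= 1]. *)
Lemma shifted_total_ge j e : - (2 * mc)^-1 <= e ->
  m%:R - 2^-1 + j%:R <= shifted_total j e.
Proof.
move=> he; have mc0 := mc_gt0; rewrite /shifted_total mulrDl.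
have h1 : - 2^-1 <= e * mc.
  have := ler_wpM2r (ltW mc0) he.
  by rewrite mulNr invfM -mulrA mulVf ?mulr1 // gt_eqF.
have h2 : j%:R <= j%:R * mc :> R.
  by rewrite ler_peMr // /mc ler1n muln_gt0 c1 andbT (ltn_trans _ m2).
have : m%:R <= T0 by rewrite ler_nat.
lra.
Qed.

Lemma alpha_at_shifted_ge1 s j e : - (2 * mc)^-1 <= e -> 1 <= alpha_at m c s (shifted_total j e).
Proof.
move=> he; apply: alpha_at_ge1; have := shifted_total_ge j he.
have : 0 <= j%:R :> R by []. lra.
Qed.

Lemma alpha_prod_ge1 s n e : - (2 * mc)^-1 <= e -> 1 <= alpha_prod s n e.
Proof.
move=> he; apply: (big_ind (fun x : R => 1 <= x)) => //.
  by move=> x y hx hy; rewrite mulr_ege1.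
by move=> j _; exact: alpha_at_shifted_ge1.
Qed.

Lemma alpha_prod_gt0 s n e : - (2 * mc)^-1 <= e -> 0 < alpha_prod s n e.
Proof. by move=> he; rewrite (lt_le_trans ltr01) // alpha_prod_ge1. Qed.

Lemma alpha_at_shifted_le s j e e' : - (2 * mc)^-1 <= e -> e <= e' ->
  alpha_at m c s (shifted_total j e') <= alpha_at m c s (shifted_total j e).
Proof.
move=> he ee'.
have -> : shifted_total j e' = shifted_total j e + (e' - e) * mc.
  by rewrite /shifted_total; ring.
apply: alpha_at_le; last by rewrite mulr_ge0 ?subr_ge0 // ltW // mc_gt0.
have := shifted_total_ge j he; have : 0 <= j%:R :> R by []. lra.
Qed.

Let K s : R := alpha_lip R m c s * mc * 4.

Lemma alpha_lip_ge0 s : 0 <= alpha_lip R m c s.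
Proof.
by apply: sumr_ge0 => l _; rewrite !mulr_ge0 ?exprn_ge0.
Qed.

Let K_ge0 s : 0 <= K s.
Proof. by rewrite /K !mulr_ge0 ?alpha_lip_ge0 // ltW // mc_gt0. Qed.

(** The additive estimate becomes multiplicative because the factors are at least 1:
    [a <= b + X <= b (1 + X) <= b exp X]. *)
Lemma alpha_at_shifted_diff s j e e' : - (2 * mc)^-1 <= e -> e <= e' ->
  alpha_at m c s (shifted_total j e) <=
  alpha_at m c s (shifted_total j e') * expR (K s * (e' - e) * j.+1%:R ^- 2).
Proof.
move=> he ee'; set a := alpha_at _ _ _ _; set b := alpha_at _ _ _ _.
have mc0 := mc_gt0.
have j0 : 0 <= j%:R :> R by [].
have Tj := shifted_total_ge j he.
have h0 : 0 <= (e' - e) * mc by rewrite mulr_ge0 ?subr_ge0 // ltW.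
have Tj' : m%:R - 2^-1 <= shifted_total j e by lra.
have := @alpha_at_diff R m c s _ _ Tj' h0.
have <- : shifted_total j e' = shifted_total j e + (e' - e) * mc.
  by rewrite /shifted_total; ring.
rewrite -/a -/b => hab.
have b1 : 1 <= b by apply: alpha_at_shifted_ge1; exact: le_trans ee'.
set X := K s * (e' - e) * j.+1%:R ^- 2.
have X0 : 0 <= X.
  apply: mulr_ge0; last by rewrite invr_ge0 exprn_ge0.
  by apply: mulr_ge0; [exact: K_ge0|rewrite subr_ge0].
have hX : a - b <= X.
  apply: le_trans hab _; rewrite /X /K.
  set D := shifted_total j e - m%:R + 1.
  (* Squaring this bound produces the factor 4 in [K]. *)
  have D2 : 2^-1 * j.+1%:R <= D by rewrite /D -[j.+1%:R]natr1; lra.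
  have D0 : 0 < 2^-1 * j.+1%:R :> R by rewrite mulr_gt0.
  have -> : alpha_lip R m c s * mc * 4 * (e' - e) * j.+1%:R ^- 2 =
     alpha_lip R m c s * ((e' - e) * mc) * ((2^-1 * j.+1%:R) ^+ 2)^-1.
    by have n0 : j.+1%:R != 0 :> R by []; field; rewrite nat1r.
  rewrite ler_wpM2l ?mulr_ge0 ?alpha_lip_ge0 ?subr_ge0 ?(ltW mc0) //.
  by rewrite lef_pV2 ?posrE ?exprn_gt0 ?(lt_le_trans D0) // lerXn2r ?nnegrE // ltW // (lt_le_trans D0).
apply: (@le_trans _ _ (b * (1 + X))).
  have : X <= b * X by rewrite ler_peMl.
  lra.
by rewrite ler_wpM2l ?expR_ge1Dx //; lra.
Qed.

Lemma sum_inv_sq_le (n : nat) : \sum_(j < n) j.+1%:R ^- 2 <= 2 :> R.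
Proof.
case: n => [|n]; first by rewrite big_ord0.
(* Strengthened so that the induction telescopes. *)
apply: (@le_trans _ _ (2 - n.+1%:R^-1)); last by rewrite gerBl invr_ge0.
elim: n => [|n IH]; first by rewrite big_ord1 expr1n invr1; lra.
rewrite big_ord_recr /=; apply: le_trans (lerD IH (lexx _)) _.
have n1 : 0 < n.+1%:R :> R by [].
rewrite -[n.+2%:R]natr1; set x : R := n.+1%:R in n1 *.
have : (x + 1) ^- 2 <= x^-1 - (x + 1)^-1.
  have -> : x^-1 - (x + 1)^-1 = (x * (x + 1))^-1 by field; apply/andP; split; lra.
  have x1 : 0 < x + 1 by lra.
  rewrite lef_pV2 ?posrE ?mulr_gt0 ?exprn_gt0 // expr2 ler_wpM2r ?(ltW x1) //; lra.
by move: ((x + 1) ^- 2) x^-1 (x + 1)^-1 => a b e; lra.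
Qed.

Lemma alpha_prod_le s n e e' : - (2 * mc)^-1 <= e -> e <= e' ->
  alpha_prod s n e' <= alpha_prod s n e.
Proof.
move=> he ee'; apply: ler_prod => j _; apply/andP; split.
  by rewrite (le_trans ler01) // alpha_at_shifted_ge1 // (le_trans he).
exact: alpha_at_shifted_le.
Qed.

Lemma alpha_prod_le_exp s n e e' : - (2 * mc)^-1 <= e -> e <= e' ->
  alpha_prod s n e <= alpha_prod s n e' * expR (K s * 2 * (e' - e)).
Proof.
move=> he ee'.
apply: (@le_trans _ _ (\prod_(j < n) (alpha_at m c s (shifted_total j e') *
    expR (K s * (e' - e) * j.+1%:R ^- 2)))).
  apply: ler_prod => j _; apply/andP; split; last exact: alpha_at_shifted_diff.
  by rewrite (le_trans ler01) // alpha_at_shifted_ge1.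
rewrite big_split /= -expR_sum ler_wpM2l //.
  by apply/ltW/alpha_prod_gt0; exact: le_trans ee'.
rewrite ler_expR -mulr_sumr mulrAC; apply: ler_wpM2r; first by rewrite subr_ge0.
by apply: ler_wpM2l; [exact: K_ge0|exact: sum_inv_sq_le].
Qed.

Lemma alpha_prodS s n e :
  alpha_prod s n.+1 e = alpha_prod s n e * alpha_at m c s (shifted_total n e).
Proof. by rewrite /alpha_prod big_ord_recr. Qed.

(** Each new factor of the ratio is at least 1, because [alpha_at] does not increase with the
    total. *)
Lemma alpha_prod_ratio_nd s e e' : - (2 * mc)^-1 <= e -> e <= e' ->
  nondecreasing_seq (fun n => alpha_prod s n e / alpha_prod s n e').
Proof.
move=> he ee'; have he' := le_trans he ee'.
apply/nondecreasing_seqP => n; rewrite !alpha_prodS invfM mulrACA.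
have a1 := alpha_at_shifted_ge1 s n he'.
apply: ler_peMr; first by rewrite divr_ge0 // ltW // alpha_prod_gt0.
by rewrite ler_pdivlMr ?mul1r; [exact: alpha_at_shifted_le|lra].
Qed.

End AlphaProducts.

(** * The polynomial with roots - lambda *)

Lemma gbinom_real (R : realType) (r : R) l : gbinom r%:C l = (gbinom r l)%:C.
Proof.
rewrite /gbinom rmorphM fmorphV rmorph_nat rmorph_prod; congr (_ / _).
by apply: eq_bigr => i _; rewrite rmorphB rmorph_nat.
Qed.

Lemma gbinom_mul (F : numFieldType) (y : F) (l s : nat) : (l <= s)%N ->
  gbinom y l * gbinom (y - l%:R) (s - l) = 'C(s, l)%:R * gbinom y s.
Proof.
move=> ls; rewrite /gbinom.
have f0 k : k`!%:R != 0 :> F by rewrite pnatr_eq0 -lt0n fact_gt0.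
have -> : \prod_(i < s) (y - i%:R) =
    \prod_(i < l) (y - i%:R) * \prod_(i < s - l) (y - l%:R - i%:R).
  rewrite -(big_mkord xpredT (fun i => y - i%:R)) (@big_cat_nat _ _ _ l) //=.
  rewrite big_mkord; congr (_ * _); rewrite -{1}(add0n l) big_addn big_mkord.
  by apply: eq_bigr => i _; rewrite natrD opprD addrA addrAC.
have := bin_fact ls => /(congr1 (fun k => k%:R : F)); rewrite !natrM => <-.
have b0 : 'C(s, l)%:R != 0 :> F by rewrite pnatr_eq0 -lt0n bin_gt0.
by field; rewrite !f0 b0.
Qed.

Lemma gbinom_affine (F : fieldType) (x a y : F) k : a != 0 ->
  gbinom (x * a + y) k = a ^+ k / k`!%:R * \prod_(i < k) (x + (y - i%:R) / a).
Proof.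
move=> a0; rewrite /gbinom mulrAC; congr (_ / _).
rewrite -[in a ^+ k](card_ord k) -prodr_const -big_split /=; apply: eq_bigr => i _.
by field.
Qed.

Section Lambda.
Variables (R : realType) (m c W0 B0 : nat).
Hypotheses (m2 : (2 <= m)%N) (c1 : (1 <= c)%N) (mT : (m <= W0 + B0)%N).

Let mc : R := (m * c)%:R.
Local Notation total_at := (shifted_total m c W0 B0).

Definition pole (l : nat) : R := ((W0 + B0)%:R + 1 - l%:R) / mc.

(** The defining polynomial at [x = j + e]. By [gbinom_mul], [gbinom (T - l) (s - l)] is
    ['C(s, l) * gbinom T s / gbinom T l], so the sum is [alpha_at] times [gbinom T s], whose linear
    factors are the [j + e + pole l]. *)
Lemma alpha_at_lambda_real (s j : nat) (e : R) : - (2 * mc)^-1 <= e ->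
  s`!%:R / mc ^+ s * \sum_(l < s.+1) c%:R ^+ l * 'C(m, l)%:R *
        gbinom ((j%:R + e) * mc + (W0 + B0)%:R - l%:R) (s - l) =
  alpha_at m c s (total_at j e) * \prod_(1 <= l < s.+1) (j%:R + e + pole l).
Proof.
move=> he; have mc0 : mc != 0 by rewrite gt_eqF // mc_gt0.
have -> : (j%:R + e) * mc + (W0 + B0)%:R = total_at j e.
  by rewrite /shifted_total addrC.
set T := total_at j e.
have Tm : m%:R - 1 < T.
  have := shifted_total_ge m2 c1 mT j he; rewrite -/T.
  by have : 0 <= j%:R :> R by []; lra.
have -> : \sum_(l < s.+1) c%:R ^+ l * 'C(m, l)%:R * gbinom (T - l%:R) (s - l) =
    alpha_at m c s T * gbinom T s.
  rewrite mulr_suml; apply: eq_bigr => l _; have [lm|ml] := leqP l m; last first.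
    by rewrite (@bin_small m) // muln0 !mulr0 !mul0r.
  have g0 : gbinom T l != 0.
    rewrite /gbinom mulf_neq0 ?invr_eq0 ?pnatr_eq0 -?lt0n ?fact_gt0 //.
    by rewrite gt_eqF // (@falling_gt0 R m).
  have := @gbinom_mul R T l s; rewrite -ltnS ltn_ord => /(_ isT) h.
  by rewrite natrM; apply: (mulfI g0); rewrite mulrCA h; field.
rewrite mulrCA; congr (_ * _).
rewrite /T /shifted_total addrC gbinom_affine // big_add1 big_mkord.
rewrite mulrA; have -> : s`!%:R / mc ^+ s * (mc ^+ s / s`!%:R) = 1.
  by field; rewrite expf_neq0 // pnatr_eq0 -lt0n fact_gt0.
rewrite mul1r; apply: eq_bigr => i _; rewrite /pole -[i.+1%:R]natr1.
by congr (_ + _ / _); ring.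
Qed.

Lemma alpha_at_lambda (s j : nat) (e : R) (lam : nat -> R[i]) :
  is_lambda m c W0 B0 s lam -> - (2 * mc)^-1 <= e ->
  \prod_(1 <= l < s.+1) ((j%:R + e)%:C + lam l) =
  (alpha_at m c s (total_at j e) * \prod_(1 <= l < s.+1) (j%:R + e + pole l))%:C.
Proof.
move=> hl he; rewrite -hl -alpha_at_lambda_real //.
have CM (x y : R) : (x * y)%:C = x%:C * y%:C by rewrite rmorphM.
rewrite !CM fmorphV rmorphXn !rmorph_nat rmorph_sum /=; congr (_ * _).
apply: eq_bigr => l _; rewrite CM [(c%:R ^+ l * _)%:C]CM rmorphXn !rmorph_nat -gbinom_real.
congr (_ * gbinom _ _); rewrite [RHS]rmorphB; congr (_ - _); rewrite ?rmorph_nat //.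
rewrite [RHS]rmorphD /=; congr (_ + _); rewrite ?rmorph_nat //.
by rewrite [RHS]CM rmorph_nat.
Qed.

(** The natural numbers supply more roots of the difference than a nonzero polynomial can have. *)
Lemma poly_eq_fun (F : numFieldType) (p q : {poly F}) : (forall x, p.[x] = q.[x]) -> p = q.
Proof.
move=> pq; apply/eqP; rewrite -subr_eq0; apply: contraT => pq0.
have := @max_poly_roots _ _ [seq i%:R | i <- iota 0 (size (p - q))] pq0.
rewrite size_map size_iota ltnn => h; apply: h.
  by apply/allP => x _; rewrite /root hornerD hornerN pq subrr.
by rewrite map_inj_uniq ?iota_uniq // => i j /eqP; rewrite eqr_nat => /eqP.
Qed.

(** By [gbinom_affine] each binomial of the defining equation is this constant times monic linear
    factors, whose zeros are the [lambda_root l i]. *)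
Definition lambda_coef (s l : nat) : R[i] :=
  s`!%:R / (m * c)%:R ^+ s * (c%:R ^+ l * 'C(m, l)%:R * ((m * c)%:R ^+ (s - l) / (s - l)`!%:R)).

Definition lambda_root (l i : nat) : R[i] := - (((W0 + B0)%:R - l%:R - i%:R) / (m * c)%:R).

Definition lambda_poly (s : nat) : {poly R[i]} :=
  \sum_(l < s.+1) lambda_coef s l *: \prod_(i < s - l) ('X - (lambda_root l i)%:P).

Let mcC : (m * c)%:R != 0 :> R[i].
Proof. by rewrite pnatr_eq0 -lt0n muln_gt0 c1 andbT (ltn_trans _ m2). Qed.

Lemma horner_lambda_poly s x : (lambda_poly s).[x] =
  s`!%:R / (m * c)%:R ^+ s * \sum_(l < s.+1) c%:R ^+ l * 'C(m, l)%:R *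
        gbinom (x * (m * c)%:R + (W0 + B0)%:R - l%:R) (s - l).
Proof.
rewrite /lambda_poly horner_sum mulr_sumr; apply: eq_bigr => l _.
rewrite -addrA gbinom_affine // hornerZ horner_prod /lambda_coef !mulrA.
congr (_ * _); apply: eq_bigr => i _.
by rewrite hornerXsubC opprK.
Qed.

Lemma size_lambda_term s l : size (\prod_(i < s - l) ('X - (lambda_root l i)%:P)) = (s - l).+1.
Proof. by rewrite size_prod_XsubC -[index_enum _]enumT size_enum_ord. Qed.

Lemma lambda_coef0 s : lambda_coef s 0 = 1.
Proof.
rewrite /lambda_coef expr0 bin0 mul1r subn0 mul1r; field.
by rewrite expf_neq0 // pnatr_eq0 -lt0n fact_gt0.
Qed.

(** Here [c * m] cancels one factor [m * c]; this value is the summand [s] in [sum_lambda]. *)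
Lemma lambda_coef1 s : lambda_coef s.+1 1 = s.+1%:R.
Proof.
rewrite /lambda_coef expr1 bin1 subn1 /= factS natrM exprS.
have f0 : s`!%:R != 0 :> R[i] by rewrite pnatr_eq0 -lt0n fact_gt0.
have -> : c%:R * m%:R = (m * c)%:R :> R[i] by rewrite natrM mulrC.
have := mcC; set a := (m * c)%:R => a0.
by field; rewrite f0 expf_neq0 // !pnatr_eq0 -!lt0n c1 (ltnW m2).
Qed.

Lemma coef_prod_XsubC_sum (F : comNzRingType) (I : eqType) (r : seq I) (f : I -> F) (k : nat) :
  size r = k.+1 -> (\prod_(i <- r) ('X - (f i)%:P))`_k = - \sum_(i <- r) f i.
Proof.
move=> sr; have := @coefPn_prod_XsubC F [seq f i | i <- r].
rewrite !big_map size_map sr /= => ->//.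
Qed.

Lemma coef_lambda_term_lead s l : (\prod_(i < s - l) ('X - (lambda_root l i)%:P))`_(s - l) = 1.
Proof.
have := lead_coef_prod_XsubC (index_enum 'I_(s - l)) xpredT (fun i => lambda_root l i).
by rewrite lead_coefE size_lambda_term.
Qed.

Lemma coef_lambda_term_small s l k : (s - l < k)%N ->
  (\prod_(i < s - l) ('X - (lambda_root l i)%:P))`_k = 0.
Proof. by move=> h; rewrite nth_default // size_lambda_term. Qed.

Lemma coef_lambda_poly_lead s : (lambda_poly s)`_s = 1.
Proof.
rewrite /lambda_poly coef_sum big_ord_recl coefZ lambda_coef0 mul1r.
have := coef_lambda_term_lead s 0; rewrite subn0 => ->; rewrite big1 ?addr0 // => l _.
rewrite coefZ coef_lambda_term_small ?mulr0 // lift0; have := ltn_ord l; lia.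
Qed.

Lemma size_lambda_poly s : size (lambda_poly s) = s.+1.
Proof.
apply/eqP; rewrite eqn_leq; apply/andP; split; last first.
  rewrite ltnNge; apply/negP => /leq_sizeP/(_ s (leqnn s)).
  by rewrite coef_lambda_poly_lead => /eqP; rewrite oner_eq0.
apply/leq_sizeP => k sk; rewrite /lambda_poly coef_sum big1 // => l _.
by rewrite coefZ coef_lambda_term_small ?mulr0 //; lia.
Qed.

(** [R[i]] is algebraically closed. The roots are listed from 0, [lam] from 1. *)
Lemma exists_lambda s : exists lam, is_lambda (R := R) m c W0 B0 s lam.
Proof.
have [r hr] := closed_field_poly_normal (lambda_poly s).
have lc : lead_coef (lambda_poly s) = 1.
  by rewrite lead_coefE size_lambda_poly coef_lambda_poly_lead.
move: hr; rewrite lc scale1r => hr.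
have sr : size r = s.
  by have := size_lambda_poly s; rewrite hr size_prod_XsubC => -[].
exists (fun l => - r`_l.-1) => x; rewrite -horner_lambda_poly hr horner_prod.
rewrite (big_nth 0) sr big_add1 /=; apply: eq_bigr => i _.
by rewrite hornerXsubC.
Qed.

Lemma lambda_poly_prod s (lam : nat -> R[i]) : is_lambda m c W0 B0 s lam ->
  lambda_poly s = \prod_(1 <= l < s.+1) ('X - (- lam l)%:P).
Proof.
move=> hl; apply: poly_eq_fun => x; rewrite horner_lambda_poly hl horner_prod.
by apply: eq_bigr => l _; rewrite hornerXsubC opprK.
Qed.

(** Compares the coefficients of [x^(s-1)]: the [l]-th term has degree [s - l], so only [l = 0] and
    [l = 1] contribute. The excess [s] becomes the exponent in [n^s]. *)
Lemma sum_lambda s (lam : nat -> R[i]) : is_lambda m c W0 B0 s lam ->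
  \sum_(1 <= l < s.+1) lam l =
  \sum_(1 <= l < s.+1) (((W0 + B0)%:R + 1 - l%:R) / (m * c)%:R) + s%:R.
Proof.
case: s => [|s] hl; first by rewrite !big_geq // addr0.
have := lambda_poly_prod hl => /(congr1 (fun p : {poly R[i]} => p`_s)).
rewrite coef_prod_XsubC_sum ?size_iota // sumrN opprK => <-.
rewrite /lambda_poly coef_sum big_ord_recl coefZ lambda_coef0 mul1r.
rewrite coef_prod_XsubC_sum; last by rewrite -[index_enum _]enumT size_enum_ord.
rewrite -sumrN big_add1 big_mkord; congr (_ + _).
  apply: eq_bigr => i _; rewrite opprK subr0 -[i.+1%:R]natr1; congr (_ / _); ring.
rewrite big_ord_recl coefZ /= /bump leq0n addn0 lambda_coef1.
have := coef_lambda_term_lead s.+1 1; rewrite subn1 /= => ->.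
rewrite mulr1 big1 ?addr0 // => l _.
rewrite coefZ coef_lambda_term_small ?mulr0 // /bump /=; have := ltn_ord l; lia.
Qed.

End Lambda.

(** * The quotient of Gamma products *)

Section ComplexLimits.
Variable R : realType.

Lemma Im_le_norm (z : R[i]) : `|complex.Im z| <= Normc.normc z.
Proof.
case: z => a b /=; rewrite -sqrtr_sqr ler_sqrt ?lerDr ?sqr_ge0 //.
by rewrite addr_ge0 ?sqr_ge0.
Qed.

Lemma cvg_Re_Im (T : Type) (F : set_system T) {FF : Filter F} (u : T -> R[i]) (l : R[i]) :
  (u x : R[i]^o) @[x --> F] --> (l : R[i]^o) ->
  complex.Re (u x) @[x --> F] --> complex.Re l /\
  complex.Im (u x) @[x --> F] --> complex.Im l.
Proof.
move=> /cvgrPdist_lt h; split; apply/cvgrPdist_lt => e e0.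
  have e0C : 0 < e%:C by rewrite ltcR.
  near=> x; rewrite -cReB (le_lt_trans (Re_le_norm _)) // -ltcR -normcR.
  by near: x; exact: h.
have e0C : 0 < e%:C by rewrite ltcR.
near=> x; rewrite -cImB (le_lt_trans (Im_le_norm _)) // -ltcR -normcR.
by near: x; exact: h.
Unshelve. all: by end_near. Qed.

Lemma cvg_real_complex (T : Type) (F : set_system T) {FF : ProperFilter F}
    (u : T -> R) (L : R[i]) :
  ((u x)%:C : R[i]^o) @[x --> F] --> (L : R[i]^o) ->
  u x @[x --> F] --> complex.Re L /\ L = (complex.Re L)%:C.
Proof.
move=> /cvg_Re_Im [hr hi]; split => //.
have hi0 : complex.Im L = 0.
  by apply: (@cvg_unique _ (@Rhausdorff R) _ _ _ _ hi (cvg_cst 0)).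
by move: hi0 {hr hi}; case: L => a b /= ->.
Qed.

Lemma cvg_complex_real (T : Type) (F : set_system T) {FF : Filter F} (u : T -> R) (l : R) :
  u x @[x --> F] --> l -> ((u x)%:C : R[i]^o) @[x --> F] --> (l%:C : R[i]^o).
Proof. by move=> h; apply: cvg_complex => //=; exact: cvg_cst. Qed.

Lemma cvg_prod_nat (K : numFieldType) (T : Type) (F : set_system T) {FF : Filter F}
    (a b : nat) (f : nat -> T -> K) (g : nat -> K) :
  (forall l, (a <= l < b)%N -> (f l x : K^o) @[x --> F] --> (g l : K^o)) ->
  (\prod_(a <= l < b) f l x : K^o) @[x --> F] --> (\prod_(a <= l < b) g l : K^o).
Proof.
elim: b => [|b IH] h.
  by under eq_fun do rewrite big_geq //; rewrite big_geq //; exact: cvg_cst.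
have [ab|ba] := leqP a b; last first.
  by under eq_fun do rewrite big_geq //; rewrite big_geq //; exact: cvg_cst.
under eq_fun do rewrite big_nat_recr //=; rewrite big_nat_recr //=.
apply: cvgM; last by apply: h; rewrite ab ltnSn.
by apply: IH => l /andP[al lb]; apply: h; rewrite al ltnW.
Qed.

Lemma near_shift_neq0 (z : R[i]) : \forall e \near (0 : R)^', forall i : nat,
  z + e%:C + i%:R != 0.
Proof.
(* For [|e| < 1] and [i >= N] the real part is positive, so only finitely many [i] exclude a value
   of [e]. *)
pose N := (Num.truncn `|complex.Re z|).+2.
have hN : `|complex.Re z| + 1 < N%:R.
  by rewrite -[N%:R]natr1 ltrD2r truncnS_gt.
have h1 : \forall e \near (0 : R)^', forall i : 'I_N, e != - complex.Re z - i%:R.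
  apply: filter_forall => i; set r := - complex.Re z - i%:R.
  have [r0|r0] := eqVneq r 0.
    by rewrite r0; exact: nbhs_dnbhs_neq.
  near=> e; apply/eqP => er; have : `|e| < `|r|.
    by near: e; apply: dnbhs0_lt; rewrite normr_gt0.
  by rewrite er ltxx.
near=> e => i; apply/eqP => /(congr1 (@complex.Re R)); rewrite !cReD natC /= => he.
have [iN|Ni] := ltnP i N.
  have : e != - complex.Re z - (Ordinal iN : nat)%:R by move: (Ordinal iN); near: e.
  by move/eqP; apply; rewrite /=; lra.
have e1 : `|e| < 1 by near: e; exact: dnbhs0_lt.
have : (N%:R : R) <= i%:R by rewrite ler_nat.
move: e1 hN; rewrite ltr_norml => /andP[e1 _] hN hi.
have := ler_norm (- complex.Re z); rewrite normrN; lra.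
Unshelve. all: by end_near. Qed.

End ComplexLimits.

(** * The limit of the alpha product as a quotient of Gamma products *)

Section GammaQuotient.
Variables (R : realType) (m c W0 B0 s : nat) (lam : nat -> R[i]).
Hypotheses (m2 : (2 <= m)%N) (c1 : (1 <= c)%N) (mT : (m <= W0 + B0)%N).
Hypothesis lamP : is_lambda m c W0 B0 s lam.

Let mc : R := (m * c)%:R.
Let b (l : nat) : R[i] := ((W0 + B0)%:R + 1 - l%:R) / (m * c)%:R.
Local Notation aprod n e := (alpha_prod m c W0 B0 s n e).

Definition regular_shift (e : R) : Prop := - (2 * mc)^-1 <= e /\
  forall l : nat, (1 <= l < s.+1)%N -> forall i : nat,
    b l + e%:C + i%:R != 0 /\ lam l + e%:C + i%:R != 0.

Lemma poleC l : b l = (pole R m c W0 B0 l)%:C.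
Proof.
rewrite /b /pole [RHS]rmorphM /= fmorphV rmorph_nat; congr (_ / _).
rewrite [RHS]rmorphB /=; congr (_ - _); rewrite ?rmorph_nat //.
by rewrite [RHS]rmorphD /= rmorph1 rmorph_nat.
Qed.

Lemma prod_cpowR (t : R) (u v : nat) (f : nat -> R[i]) : 0 < t ->
  \prod_(u <= l < v) cpowR t (f l) = cpowR t (\sum_(u <= l < v) f l).
Proof.
move=> t0; elim/big_rec2 : _ => [|l x y _ ->].
  by have := @cpowR_nat R t 0 t0; rewrite expr0.
by rewrite cpowRD.
Qed.

Lemma prod_gauss (f : nat -> R[i]) n : (0 < n)%N ->
  \prod_(1 <= l < s.+1) gauss (f l) n =
  cpowR n%:R (\sum_(1 <= l < s.+1) f l) * n`!%:R ^+ s /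
    \prod_(i < n.+1) \prod_(1 <= l < s.+1) (f l + i%:R).
Proof.
move=> n0; rewrite /gauss big_split /= [X in X * _ = _]big_split /= prod_cpowR ?ltr0n //.
congr (_ * _ * _).
  by rewrite big_const_nat subn1 iter_mulr_1.
by rewrite exchange_big /= prodfV.
Qed.

(** An identity at finite [n]: the factorials cancel, [sum_lambda] leaves [n^s] below, and Gauss's
    product has [n + 1] linear factors, whence the index [n.+1]. *)
Lemma prod_gauss_quot e n : (0 < n)%N -> regular_shift e ->
  (\prod_(1 <= l < s.+1) gauss (b l + e%:C) n) /
  (\prod_(1 <= l < s.+1) gauss (lam l + e%:C) n) =
  (aprod n.+1 e / n%:R ^+ s)%:C.
Proof.
move=> n0 [he reg]; have n0' : 0 < n%:R :> R by rewrite ltr0n.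
rewrite !prod_gauss //.
have -> : \sum_(1 <= l < s.+1) (lam l + e%:C) = \sum_(1 <= l < s.+1) (b l + e%:C) + s%:R.
  by rewrite !big_split /= (sum_lambda m2 c1 mT lamP) addrAC.
have -> : \prod_(i < n.+1) \prod_(1 <= l < s.+1) (lam l + e%:C + i%:R) =
   (aprod n.+1 e)%:C *
   \prod_(i < n.+1) \prod_(1 <= l < s.+1) (b l + e%:C + i%:R).
  rewrite /alpha_prod rmorph_prod -big_split /=; apply: eq_bigr => i _.
  transitivity (\prod_(1 <= l < s.+1) ((i%:R + e)%:C + lam l)).
    by apply: eq_bigr => l _; rewrite rmorphD rmorph_nat; ring.
  rewrite (alpha_at_lambda m2 c1 mT _ lamP he) rmorphM rmorph_prod; congr (_ * _).
  apply: eq_bigr => l _; rewrite poleC !rmorphD rmorph_nat; ring.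
have b0 : \prod_(i < n.+1) \prod_(1 <= l < s.+1) (b l + e%:C + i%:R) != 0.
  apply/prodf_neq0 => i _; rewrite prodf_seq_neq0; apply/allP => l.
  rewrite mem_index_iota => ls /=; by have [] := reg l ls i.
rewrite cpowRD // cpowR_nat //.
have cp0 := cpowR_neq0 (\sum_(1 <= l < s.+1) (b l + e%:C)) n0'.
have a0 : (aprod n.+1 e)%:C != 0.
  by rewrite fmorph_eq0 gt_eqF // alpha_prod_gt0.
have ns : (n%:R ^+ s)%:C != 0 :> R[i].
  by rewrite fmorph_eq0 gt_eqF // exprn_gt0.
have f0 : n`!%:R ^+ s != 0 :> R[i].
  by rewrite expf_neq0 // pnatr_eq0 -lt0n fact_gt0.
rewrite [RHS]rmorphM fmorphV.
move: cp0 b0 a0 ns f0; set X := cpowR _ _; set Y := \prod_(i < n.+1) _.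
move=> cp0 b0 a0 ns f0; field.
by apply/and5P; split.
Qed.

Lemma ratio_cvg1 : ((n%:R / n.+1%:R) ^+ s : R) @[n --> \oo] --> (1 : R).
Proof.
have h : (1 - n.+1%:R^-1 : R) @[n --> \oo] --> (1 : R).
  rewrite -[X in _ --> X]subr0; apply: cvgB; [exact: cvg_cst|exact: cvg_harmonic].
have h2 : (n%:R / n.+1%:R : R) @[n --> \oo] --> (1 : R).
  apply: cvg_trans h; apply: near_eq_cvg; near=> n.
  have n0 : n.+1%:R != 0 :> R by [].
  by apply: (mulIf n0); rewrite divfK // mulrBl mul1r mulVf // -natr1 addrK.
rewrite -[X in _ --> X](expr1n _ s).
apply: (cvg_comp (fun n => n%:R / n.+1%:R : R) (fun x : R => x ^+ s)); first exact: h2.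
exact: exprn_continuous.
Unshelve. all: by end_near. Qed.

Lemma Gamma_quotE e : Gamma_quot m c W0 B0 s lam e =
  (\prod_(1 <= l < s.+1) Gamma (b l + e%:C)) / (\prod_(1 <= l < s.+1) Gamma (lam l + e%:C)).
Proof. by []. Qed.

(** Although the [lam l] may be complex, the quotient is a limit of positive reals; it is not 0
    because Gamma has no zeros off its poles. *)
Lemma Gamma_quot_cvg e : regular_shift e ->
  [/\ aprod n e / n%:R ^+ s @[n --> \oo] --> complex.Re (Gamma_quot m c W0 B0 s lam e),
    Gamma_quot m c W0 B0 s lam e = (complex.Re (Gamma_quot m c W0 B0 s lam e))%:C &
    0 < complex.Re (Gamma_quot m c W0 B0 s lam e)].
Proof.
move=> he; have [he1 reg] := he.
have lam0 l i : (1 <= l < s.+1)%N -> lam l + e%:C + i%:R != 0.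
  by move=> ls; have [] := reg l ls i.
have b0 l i : (1 <= l < s.+1)%N -> b l + e%:C + i%:R != 0.
  by move=> ls; have [] := reg l ls i.
have prod_neq0 (f : nat -> R[i]) : (forall l i, (1 <= l < s.+1)%N -> f l + i%:R != 0) ->
    \prod_(1 <= l < s.+1) Gamma (f l) != 0.
  move=> hf; rewrite prodf_seq_neq0; apply/allP => l; rewrite mem_index_iota => ls /=.
  by apply: Gamma_neq0 => i; exact: hf.
have gq0 : Gamma_quot m c W0 B0 s lam e != 0.
  by rewrite Gamma_quotE mulf_neq0 ?invr_eq0 // prod_neq0.
have h : ((\prod_(1 <= l < s.+1) gauss (b l + e%:C) n) /
    (\prod_(1 <= l < s.+1) gauss (lam l + e%:C) n) : R[i]^o) @[n --> \oo] -->
    (Gamma_quot m c W0 B0 s lam e : R[i]^o).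
  rewrite Gamma_quotE; apply: cvgM.
    by apply: cvg_prod_nat => l ls; apply: gauss_cvg_Gamma => i; exact: b0.
  apply: cvgV; first exact: prod_neq0.
  by apply: cvg_prod_nat => l ls; apply: gauss_cvg_Gamma => i; exact: lam0.
have {}h : ((aprod n.+1 e / n%:R ^+ s)%:C : R[i]^o) @[n --> \oo] -->
    (Gamma_quot m c W0 B0 s lam e : R[i]^o).
  apply: cvg_trans h; apply: near_eq_cvg; near=> n.
  by apply: prod_gauss_quot => //; near: n; exists 1%N.
have [h1 h2] := cvg_real_complex h.
have h3 : aprod n e / n%:R ^+ s @[n --> \oo] --> complex.Re (Gamma_quot m c W0 B0 s lam e).
  have h4 : (aprod n.+1 e / n%:R ^+ s * (n%:R / n.+1%:R) ^+ s : R) @[n --> \oo] -->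
      complex.Re (Gamma_quot m c W0 B0 s lam e).
    by rewrite -[complex.Re _]mulr1; exact: cvgM h1 ratio_cvg1.
  rewrite -cvg_shiftS /=; apply: cvg_trans h4; apply: near_eq_cvg; near=> n.
  have n0 : n%:R != 0 :> R by rewrite pnatr_eq0 -lt0n; near: n; exists 1%N.
  rewrite /= expr_div_n; have n1 : n.+1%:R ^+ s != 0 :> R by rewrite expf_neq0.
  have ns : n%:R ^+ s != 0 :> R by rewrite expf_neq0.
  by rewrite mulrA mulfVK.
split => //.
rewrite lt_neqAle; apply/andP; split.
  by apply: contra gq0; rewrite eq_sym h2 => /eqP ->.
rewrite -(cvg_lim (@Rhausdorff R) h3); apply: limr_ge; first by apply/cvg_ex; eexists; exact: h3.
apply: nearW => n; rewrite divr_ge0 ?exprn_ge0 //.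
by apply/ltW/alpha_prod_gt0.
Unshelve. all: by end_near. Qed.

Lemma mc_inv_gt0 : 0 < (2 * mc)^-1.
Proof. by rewrite invr_gt0 mulr_gt0 // mc_gt0. Qed.

Lemma near_regular_shift : \forall e \near (0 : R)^', regular_shift e.
Proof.
have h1 : \forall e \near (0 : R)^', forall i : 'I_s.+1, forall k : nat,
    b i + e%:C + k%:R != 0 /\ lam i + e%:C + k%:R != 0.
  apply: filter_forall => i.
  have := near_shift_neq0 (lam i); have := near_shift_neq0 (b i).
  by apply: filterS2 => e hb hl k.
near=> e; split.
  have : `|e| < (2 * mc)^-1 by near: e; apply: dnbhs0_lt; exact: mc_inv_gt0.
  by rewrite ltr_norml => /andP[/ltW].
have h2 : forall i : 'I_s.+1, forall k : nat,
    b i + e%:C + k%:R != 0 /\ lam i + e%:C + k%:R != 0 by near: e; exact: h1.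
by move=> l /andP[_ ls] k; exact: (h2 (Ordinal ls) k).
Unshelve. all: by end_near. Qed.

(** Here all [b l] are positive. The product over [l] of [lam l + i] is [alpha] times that of
    [b l + i], hence positive, so none of its factors vanishes. *)
Lemma regular_shift0 : (s <= W0 + B0)%N -> regular_shift 0.
Proof.
move=> sT; split; first by rewrite oppr_le0 ltW // mc_inv_gt0.
have he : - (2 * mc)^-1 <= 0 by rewrite oppr_le0 ltW // mc_inv_gt0.
have pole_gt0 l : (1 <= l < s.+1)%N -> 0 < pole R m c W0 B0 l.
  move=> /andP[_ ls]; rewrite /pole divr_gt0 ?mc_gt0 //.
  have : (l%:R : R) <= (W0 + B0)%:R by rewrite ler_nat (leq_trans _ sT).
  lra.
move=> l ls i; rewrite addr0; split.
  rewrite poleC natC -rmorphD fmorph_eq0 gt_eqF //.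
  by rewrite ltr_wpDr // pole_gt0.
have : \prod_(1 <= l < s.+1) ((i%:R + 0)%:C + lam l) != 0.
  rewrite (alpha_at_lambda m2 c1 mT _ lamP he) fmorph_eq0 mulf_neq0 //.
    by rewrite gt_eqF // (lt_le_trans ltr01) // alpha_at_shifted_ge1.
  rewrite prodf_seq_neq0; apply/allP => k; rewrite mem_index_iota => ks /=.
  by rewrite addr0 gt_eqF // ltr_wpDl // pole_gt0.
rewrite prodf_seq_neq0 => /allP /(_ l); rewrite mem_index_iota => /(_ ls) /=.
suff -> : lam l + 0%:C + i%:R = (i%:R + 0)%:C + lam l by [].
by rewrite (rmorph0 (real_complex R)) !addr0 natC addrC.
Qed.

Lemma alpha_prod_cvg : exists G : R, [/\ 0 < G,
  alpha_prod m c W0 B0 s n 0 / n%:R ^+ s @[n --> \oo] --> G,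
  (fun e : R => Gamma_quot m c W0 B0 s lam e : R[i]^o) @ 0^' --> (G%:C : R[i]^o) &
  (s <= W0 + B0)%N -> Gamma_quot m c W0 B0 s lam 0 = G%:C].
Proof.
pose g e := complex.Re (Gamma_quot m c W0 B0 s lam e).
(* The last factor 2 bounds the sum of the inverse squares. *)
pose K := alpha_lip R m c s * mc * 4 * 2.
have he0 : - (2 * mc)^-1 <= 0 by rewrite oppr_le0 ltW // mc_inv_gt0.
have apos n e : - (2 * mc)^-1 <= e -> 0 < aprod n e by move=> he; apply: alpha_prod_gt0.
have bound e e' n : - (2 * mc)^-1 <= e -> e <= e' ->
    aprod n e' <= aprod n e <= aprod n e' * expR (K * (e' - e)).
  by move=> h1 h2; rewrite alpha_prod_le // alpha_prod_le_exp.
have [e0 [e00 re0]] : exists e, 0 < e /\ regular_shift e.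
  have [e /= e0 he] := near_regular_shift; exists (e / 2).
  have e2 : 0 < e / 2 by rewrite divr_gt0.
  split => //; apply: he; last by rewrite gt_eqF.
  by rewrite /= sub0r normrN gtr0_norm // gtr_pMr // invf_lt1 // ltr1n.
have [hA0 _ g0pos] := Gamma_quot_cvg re0; rewrite -/(g e0) in hA0 g0pos.
have he1 : - (2 * mc)^-1 <= e0 by have [] := re0.
(* Poles may exclude Gauss's product at 0, so the limit there is reached from the regular shift
   [e0]: [r] is monotone and bounded. *)
pose r n := aprod n 0 / aprod n e0.
have rnd : nondecreasing_seq r by apply: alpha_prod_ratio_nd => //; exact: ltW.
have rle n : r n <= expR (K * e0).
  have /andP[_] := bound 0 e0 n he0 (ltW e00).
  by rewrite subr0 mulrC /r ler_pdivrMr ?apos.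
have rcvg : cvgn r.
  apply: nondecreasing_is_cvgn => //; exists (expR (K * e0)) => _ [n _ <-]; exact: rle.
have r1 : 1 <= limn r.
  apply: limr_ge => //; apply: nearW => n; rewrite /r ler_pdivlMr ?apos // mul1r.
  by have /andP[] := bound 0 e0 n he0 (ltW e00).
pose G := g e0 * limn r.
have hG : aprod n 0 / n%:R ^+ s @[n --> \oo] --> G.
  have : aprod n e0 / n%:R ^+ s * r n @[n --> \oo] --> G by apply: cvgM.
  apply: cvg_trans; apply: near_eq_cvg; apply: nearW => n.
  by rewrite /r [X in X = _]mulrC mulrA divfK // gt_eqF // apos.
have G0 : 0 < G by rewrite mulr_gt0 // (lt_le_trans ltr01).
have gcvg e : regular_shift e -> aprod n e / n%:R ^+ s @[n --> \oo] --> g e.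
  by move=> he; have [] := Gamma_quot_cvg he.
have lecvg (e e' : R) (x y k : R) : aprod n e / n%:R ^+ s @[n --> \oo] --> x ->
    aprod n e' / n%:R ^+ s @[n --> \oo] --> y ->
    (forall n, aprod n e <= aprod n e' * k) -> x <= y * k.
  move=> hx hy hle.
  have hyk : aprod n e' / n%:R ^+ s * k @[n --> \oo] --> y * k.
    by apply: cvgMl.
  apply: (ler_cvg_to hx hyk); apply: nearW => n.
  by rewrite mulrAC ler_wpM2r ?invr_ge0 ?exprn_ge0.
exists G; split => //.
(* The comparison of A_n(e) with A_n(0) is uniform in [n] and so survives in the limits; this
   squeezes [g e] towards [G], with the roles exchanged for negative [e]. *)
- have gb e : regular_shift e ->
      G * expR (- (K * `|e|)) <= g e <= G * expR (K * `|e|).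
    move=> he; have [he2 _] := he; have hge := gcvg e he.
    have K0 : 0 <= K.
      by rewrite /K !mulr_ge0 ?alpha_lip_ge0 // ltW // mc_gt0.
    have ex1 : 1 <= expR (K * `|e|).
      by rewrite -expR0 ler_expR mulr_ge0.
    have ex2 : expR (- (K * `|e|)) <= 1.
      by rewrite -expR0 ler_expR oppr_le0 mulr_ge0.
    have [e0'|e0'] := leP 0 e.
      apply/andP; split; last first.
        apply: lecvg hge hG _ => n; have /andP[h _] := bound 0 e n he0 e0'.
        by rewrite (le_trans h) // ler_peMr // ltW // apos.
      rewrite expRN ler_pdivrMr ?expR_gt0 //; apply: lecvg hG hge _ => n.
      have /andP[_ h] := bound 0 e n he0 e0'.
      by rewrite ger0_norm // -[X in K * X]subr0.
    apply/andP; split.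
      rewrite expRN ler_pdivrMr ?expR_gt0 //; apply: lecvg hG hge _ => n.
      have /andP[h _] := bound e 0 n he2 (ltW e0').
      by rewrite (le_trans h) // ler_peMr // ltW // apos.
    apply: lecvg hge hG _ => n; have /andP[_ h] := bound e 0 n he2 (ltW e0').
    by rewrite ltr0_norm // -[X in K * X]add0r.
  have expc (k : R) : G * expR (k * `|e|) @[e --> (0 : R)^'] --> G.
    have n0 : `|e| @[e --> (0 : R)^'] --> (0 : R).
      apply/cvgrPdist_lt => d d0; near=> e; rewrite sub0r normrN normr_id.
      by near: e; exact: dnbhs0_lt.
    have k0 : k * `|e| @[e --> (0 : R)^'] --> (0 : R).
      by rewrite -[X in _ --> X](mulr0 k); exact: cvgMr.
    have x0 : expR (k * `|e|) @[e --> (0 : R)^'] --> (1 : R).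
      rewrite -expR0; exact: (cvg_comp _ _ k0 (@continuous_expR R 0)).
    by rewrite -[G in _ --> G]mulr1; exact: cvgMr.
  have hg : g e @[e --> (0 : R)^'] --> G.
    apply: (@squeeze_cvgr _ _ _ _ (fun e => G * expR (- K * `|e|))
      (fun e => G * expR (K * `|e|))); [|exact: expc|exact: expc].
    near=> e; rewrite mulNr; apply: gb; near: e; exact: near_regular_shift.
  have hgC : ((g e)%:C : R[i]^o) @[e --> (0 : R)^'] --> (G%:C : R[i]^o).
    exact: cvg_complex_real.
  apply: cvg_trans hgC; apply: near_eq_cvg; near=> e.
  have he : regular_shift e by near: e; exact: near_regular_shift.
  by have [_ <- _] := Gamma_quot_cvg he.
- move=> sT; have [h1 -> _] := Gamma_quot_cvg (regular_shift0 sT).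
  by congr (_%:C); apply: cvg_unique h1 hG.
Unshelve. all: by end_near. Qed.

End GammaQuotient.

(** * Convergence of the moments *)

Section UrnLimits.
Variables (R : realType) (d : measure_display) (Om : measurableType d).
Variables (P : probability Om R) (m c W0 B0 : nat) (K : nat -> Om -> 'I_m.+1).
Hypotheses (m2 : (2 <= m)%N) (c1 : (1 <= c)%N) (mT : (m <= W0 + B0)%N).
Hypothesis urnP : urn_process P c W0 B0 K.

Local Notation mom := (moment P c W0 K).
Local Notation al := (alpha R m c W0 B0).
Local Notation be := (beta P c W0 B0 K).
Local Notation tot := (Defs.total m c W0 B0).

Definition urn_series (s l : nat) : R := be l s / \prod_(0 <= j < l.+1) al j s.

Let he0 : - (2 * (m * c)%:R)^-1 <= 0 :> R.
Proof. by rewrite oppr_le0 invr_ge0 mulr_ge0. Qed.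

Lemma alpha_partial_gt0 s n : 0 < \prod_(0 <= j < n) al j s.
Proof. by rewrite alpha_prodE // alpha_prod_gt0. Qed.

Lemma moment_series s n : mom n s =
  (\prod_(0 <= j < n) al j s) * (W0%:R ^+ s + series (urn_series s) n).
Proof.
elim: n => [|n IH]; first by rewrite big_geq // mul1r moment0 seriesEnat /= big_geq // addr0.
rewrite (moment_rec mT urnP) IH seriesSr addrA [RHS]mulrDr /urn_series.
rewrite [X in _ = _ + X]mulrCA divff ?gt_eqF ?alpha_partial_gt0 // mulr1.
by rewrite [in RHS]big_nat_recr //= mulrA [al n s * _]mulrC.
Qed.

(** From [j C(t, j) = t C(t-1, j-1) >= t] and [j <= m]. This is where [beta] gains a factor
    [1 / tot n]. *)
Lemma bin_ratio_le (n j : nat) : (0 < j)%N ->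
  'C(m, j)%:R / 'C(tot n, j)%:R <= 'C(m, j)%:R * m%:R / (tot n)%:R :> R.
Proof.
move=> j0; have [jm|mj] := leqP j m; last by rewrite bin_small // !mul0r.
have mt : (m <= tot n)%N by rewrite (leq_trans mT) // leq_addr.
have t0 : (0 < tot n)%N by rewrite (leq_trans _ mt) // (ltn_trans _ m2).
have b0 : (0 < 'C(tot n, j))%N by rewrite bin_gt0 (leq_trans jm).
rewrite -mulrA ler_wpM2l // ler_pdivlMr ?ltr0n // mulrC ler_pdivrMr ?ltr0n //.
rewrite -natrM ler_nat (leq_trans _ (leq_mul jm (leqnn _))) //.
have := mul_bin_diag (tot n) j.-1; rewrite prednK // => <-.
by rewrite leq_pmulr // bin_gt0 -ltnS !prednK // (leq_trans jm).
Qed.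

Definition beta_bound (s : nat) : R :=
  \sum_(2 <= i < s.+1) \sum_(i <= l < s.+1) 'C(s, l)%:R * c%:R ^+ l *
      \sum_(l + 1 - i <= j < l.+1)
        (stirling2 l j * stirling1 j (l + 1 - i))%:R * ('C(m, j)%:R * m%:R).

Lemma beta_bound_ge0 s : 0 <= beta_bound s.
Proof.
apply: sumr_ge0 => i _; apply: sumr_ge0 => l _.
by rewrite mulr_ge0 ?mulr_ge0 ?exprn_ge0 // sumr_ge0 // => j _; rewrite !mulr_ge0.
Qed.

(** As [i >= 2], only moments of order at most [s - 1] occur; as [l >= i], every [j] is positive and
    [bin_ratio_le] applies. *)
Lemma beta_le s n : (0 < s)%N ->
  `|be n s| <= (tot n)%:R ^+ s.-1 / (tot n)%:R * beta_bound s.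
Proof.
move=> s0; have mt : (m <= tot n)%N by rewrite (leq_trans mT) // leq_addr.
have t0 : (0 < tot n)%N by rewrite (leq_trans _ mt) // (ltn_trans _ m2).
have t1 : 1 <= (tot n)%:R :> R by rewrite ler1n.
rewrite /beta /beta_bound mulr_sumr; apply: le_trans (ler_norm_sum _ _ _) _.
rewrite big_nat_cond [leRHS]big_nat_cond; apply: ler_sum => i /andP[/andP[i2 si] _].
rewrite normrM -mulrA; apply: ler_pM => //.
  rewrite ger0_norm ?(moment_ge0 urnP) //; apply: le_trans (moment_le urnP _ _) _.
  by rewrite ler_weXn2l //; lia.
rewrite mulrC mulr_suml; apply: le_trans (ler_norm_sum _ _ _) _.
rewrite big_nat_cond [leRHS]big_nat_cond; apply: ler_sum => l /andP[/andP[il ls] _].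
have cc : 0 <= 'C(s, l)%:R * c%:R ^+ l :> R by rewrite mulr_ge0 ?exprn_ge0.
rewrite normrM (ger0_norm cc) -[leRHS]mulrA; apply: ler_wpM2l => //.
rewrite mulr_suml; apply: le_trans (ler_norm_sum _ _ _) _.
rewrite big_nat_cond [leRHS]big_nat_cond; apply: ler_sum => j /andP[/andP[lj jl] _].
rewrite !normrM normrX normrN1 expr1n mul1r normfV !normr_nat natrM.
rewrite -!mulrA ler_wpM2l // mulrA; apply: bin_ratio_le; lia.
Qed.

Lemma urn_series_cvg s (lam : nat -> R[i]) : (0 < s)%N -> is_lambda m c W0 B0 s lam ->
  cvgn (series (urn_series s)).
Proof.
move=> s0 lamP; have [G [G0 hG _ _]] := alpha_prod_cvg m2 c1 mT lamP.
(* Positivity of [G] is essential: it bounds the reciprocals of the alpha products. *)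
have hV : (n%:R ^+ s / alpha_prod m c W0 B0 s n 0) @[n --> \oo] --> G^-1.
  have : (alpha_prod m c W0 B0 s n 0 / n%:R ^+ s)^-1 @[n --> \oo] --> G^-1.
    by apply: cvgV => //; rewrite gt_eqF.
  by under eq_fun do rewrite invf_div.
have [M hM] : exists M : R, forall n, n%:R ^+ s / alpha_prod m c W0 B0 s n 0 <= M.
  have /cvg_seq_bounded := cvgP _ hV; move=>  [M [_ hM]]; exists (M + 1) => n.
  by apply: le_trans (ler_norm _) _; apply: (hM (M + 1)) => //; rewrite ltrDl.
(* Chosen so that [tot n <= D * (n + 1)]. *)
pose D : R := (W0 + B0 + m * c)%:R.
pose C := beta_bound s * D ^+ s.-1 * M.
have C0 : 0 <= C.
  rewrite /C !mulr_ge0 ?exprn_ge0 ?beta_bound_ge0 //.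
  by apply: le_trans (hM 0%N); rewrite divr_ge0 ?exprn_ge0 // ltW // alpha_prod_gt0.
apply: normed_cvg; apply: (@series_le_cvg _ _ (fun n => C * n.+1%:R ^- 2)).
- by move=> n; rewrite normr_ge0.
- by move=> n; rewrite mulr_ge0 ?invr_ge0 ?exprn_ge0.
- move=> n; rewrite /= /urn_series normrM normfV (gtr0_norm (alpha_partial_gt0 _ _)).
  rewrite alpha_prodE; have a0 := @alpha_prod_gt0 R m c W0 B0 m2 c1 mT s n.+1 0 he0.
  have mc1 : (0 < m * c)%N by rewrite muln_gt0 c1 (ltnW m2).
  have T1 : (0 < W0 + B0)%N by rewrite (leq_trans _ mT) // ltnW.
  have tn : (n.+1 <= tot n)%N by rewrite /Defs.total -mulnA -add1n leq_add // leq_pmulr.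
  have tD : (tot n)%:R <= D * n.+1%:R.
    rewrite -natrM ler_nat /Defs.total -mulnA mulnDl leq_add ?leq_pmulr //.
    by rewrite mulnC leq_mul2l leqnSn orbT.
  have n0 : 0 < n.+1%:R :> R by [].
  have t0 : 0 < (tot n)%:R :> R by rewrite (lt_le_trans n0) // ler_nat.
  (* Exponents of [n + 1]: [s - 1] from the moments, [-1] from the binomial ratios, [-s] from the
     alpha product, in all [-2]. *)
  apply: (@le_trans _ _ (((D * n.+1%:R) ^+ s.-1 / n.+1%:R * beta_bound s) *
     (M / n.+1%:R ^+ s))).
    apply: ler_pM => //; first by rewrite invr_ge0 ltW.
      apply: le_trans (beta_le _ s0) _; rewrite ler_wpM2r ?beta_bound_ge0 //.
      apply: ler_pM; rewrite ?exprn_ge0 ?invr_ge0 //.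
        by rewrite lerXn2r ?nnegrE // mulr_ge0.
      by rewrite lef_pV2 ?posrE // ler_nat.
    rewrite ler_pdivlMr ?exprn_gt0 // mulrC; exact: hM.
  rewrite /C exprMn -[in n.+1%:R ^+ s](prednK s0) exprS le_eqVlt; apply/orP; left; apply/eqP.
  have np : n.+1%:R ^+ s.-1 != 0 :> R by rewrite expf_neq0.
  have nn : n.+1%:R != 0 :> R by [].
  by field; rewrite nat1r nn np.
- apply: nondecreasing_is_cvgn.
    apply: nondecreasing_series => n _ _.
    by rewrite mulr_ge0 ?invr_ge0 ?exprn_ge0.
  exists (C * 2) => _ [n _ <-]; rewrite seriesEord /= -mulr_sumr ler_wpM2l //.
  exact: sum_inv_sq_le.
Qed.

Lemma urn_limit s (lam : nat -> R[i]) : (0 < s)%N -> is_lambda m c W0 B0 s lam ->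
  exists G : R, [/\ (s <= W0 + B0)%N -> Gamma_quot m c W0 B0 s lam 0 = G%:C,
    (fun e : R => Gamma_quot m c W0 B0 s lam e : R[i]^o) @ 0^' --> (G%:C : R[i]^o),
    cvgn (series (urn_series s)) &
    mom n s / n%:R ^+ s @[n --> \oo] --> G * (W0%:R ^+ s + limn (series (urn_series s)))].
Proof.
move=> s0 lamP; have [G [G0 hG hq hq0]] := alpha_prod_cvg m2 c1 mT lamP.
have hu := urn_series_cvg s0 lamP.
exists G; split => //.
have h : alpha_prod m c W0 B0 s n 0 / n%:R ^+ s * (W0%:R ^+ s + series (urn_series s) n)
    @[n --> \oo] --> G * (W0%:R ^+ s + limn (series (urn_series s))).
  by apply: cvgM => //; apply: cvgD; [exact: cvg_cst|exact: hu].
apply: cvg_trans h; apply: near_eq_cvg; apply: nearW => n.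
by rewrite moment_series alpha_prodE mulrAC.
Qed.

Lemma moment_power0 n : mom n 0 = 1.
Proof.
elim: n => [|n IH]; first by rewrite moment0.
by rewrite (moment_rec mT urnP) IH /alpha /beta big_ord1 big_geq // !bin0 expr0 divr1 mulr1 addr0 mulr1.
Qed.

(** [W_n / T_n] is a martingale: for [s = 1], [alpha] is [1 + mc/T_n = T_(n+1)/T_n] and [beta] is an
    empty sum. *)
Lemma moment_power1 n : mom n 1 = W0%:R * (tot n)%:R / (W0 + B0)%:R.
Proof.
have T0 : (W0 + B0)%:R != 0 :> R.
  by rewrite pnatr_eq0 -lt0n (leq_trans _ mT) // ltnW.
elim: n => [|n IH].
  by rewrite moment0 /Defs.total !mul0n addn0 mulfK.
rewrite (moment_rec mT urnP) IH /alpha /beta big_ord_recr big_ord1 big_geq //= addr0.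
have t0 : (tot n)%:R != 0 :> R.
  by rewrite pnatr_eq0 -lt0n /Defs.total; have := ltnW m2; lia.
rewrite !bin0 !bin1 expr0 expr1 mul1n mul1r divr1.
have -> : (tot n.+1)%:R = (tot n)%:R + (m * c)%:R :> R.
  by rewrite -natrD /Defs.total; congr (_%:R); lia.
rewrite natrM; move: T0 t0; move: (W0 + B0)%:R (tot n)%:R => T t T0 t0.
by field; rewrite T0 t0.
Qed.

Lemma moment1_cvg : mom n 1 / n%:R @[n --> \oo] --> ((W0 * m * c)%:R / (W0 + B0)%:R : R).
Proof.
have T0 : (W0 + B0)%:R != 0 :> R.
  by rewrite pnatr_eq0 -lt0n (leq_trans _ mT) // ltnW.
have h : W0%:R * n%:R^-1 + (W0 * m * c)%:R / (W0 + B0)%:R @[n --> \oo] -->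
    ((W0 * m * c)%:R / (W0 + B0)%:R : R).
  rewrite -[X in _ --> X]add0r; apply: cvgD; last exact: cvg_cst.
  by rewrite -[0](mulr0 (W0%:R : R)); apply: cvgMr; exact: invn_cvg0.
apply: cvg_trans h; apply: near_eq_cvg; near=> n.
have n0 : n%:R != 0 :> R by rewrite pnatr_eq0 -lt0n; near: n; exists 1%N.
rewrite moment_power1 /Defs.total [(_ + n * m * c)%:R]natrD !natrM.
by move: T0; move: (W0 + B0)%:R => T T0; field; rewrite n0 T0.
Unshelve. all: by end_near. Qed.

End UrnLimits.

(** * The second moment *)

(** Read backwards, the falling product is a rising one starting at [a], which matches the factors
    [j + a] of the alpha product. *)
Lemma gbinom_rising (F : fieldType) (a : F) (l : nat) :
  gbinom (l%:R + a) l.+1 = (\prod_(i < l.+1) (i%:R + a)) / (l.+1)`!%:R.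
Proof.
rewrite /gbinom; congr (_ / _); rewrite (reindex_inj rev_ord_inj) /=.
apply: eq_bigr => i _; rewrite subSS natrB -1?ltnS //; ring.
Qed.

Lemma prod_nat13 (V : comNzRingType) (f : nat -> V) :
  \prod_(1 <= l < 3) f l = f 1%N * f 2.
Proof. by rewrite big_ltn // big_ltn // big_geq // mulr1. Qed.

Lemma bin2_natr (F : numFieldType) (n : nat) : (0 < n)%N ->
  'C(n, 2)%:R = n%:R * (n%:R - 1) / 2 :> F.
Proof.
move=> n0; have t2 : 2 != 0 :> F by rewrite pnatr_eq0.
apply: (mulIf t2); rewrite divfK // -natrM mulnC.
have := mul_bin_diag n 1; rewrite bin1 => <-.
by rewrite natrM -subn1 natrB.
Qed.

Section SecondMoment.
Variables (R : realType) (d : measure_display) (Om : measurableType d).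
Variables (P : probability Om R) (m c W0 B0 : nat) (K : nat -> Om -> 'I_m.+1).
Hypotheses (m2 : (2 <= m)%N) (c1 : (1 <= c)%N) (mT : (m <= W0 + B0)%N).
Hypothesis urnP : urn_process P c W0 B0 K.

Let mc : R := (m * c)%:R.
Let T0 : R := (W0 + B0)%:R.
Let rt : R := Num.sqrt (1 + 4 * mc * (1 + c%:R)).
Let lam1 : R := (- 2^-1 + mc + T0 + 2^-1 * rt) / mc.
Let lam2 : R := (- 2^-1 + mc + T0 - 2^-1 * rt) / mc.

Definition lambda2 (l : nat) : R[i] := if l == 1%N then lam1%:C else lam2%:C.

Let mc0 : mc != 0.
Proof. by rewrite gt_eqF // mc_gt0. Qed.


Lemma lambda2P : is_lambda m c W0 B0 2 lambda2.
Proof.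
move=> x; rewrite !big_ord_recr big_ord0 /= add0r !expr0 bin0 bin1 bin2_natr ?(ltnW m2) //.
rewrite prod_nat13 /lambda2 /=.
rewrite (_ : gbinom _ (2 - 0) = (x * (m * c)%:R + (W0 + B0)%:R) *
   (x * (m * c)%:R + (W0 + B0)%:R - 1) / 2); last first.
  by rewrite /gbinom !big_ord_recr big_ord0 /= mul1r !subr0.
rewrite (_ : gbinom _ (2 - 1) = x * (m * c)%:R + (W0 + B0)%:R - 1); last first.
  by rewrite /gbinom big_ord_recr big_ord0 /= mul1r subr0 divr1.
rewrite (_ : gbinom _ (2 - 2) = 1); last by rewrite /gbinom big_ord0 divr1.
have CM (u v : R) : (u * v)%:C = u%:C * v%:C by rewrite rmorphM.
have CD (u v : R) : (u + v)%:C = u%:C + v%:C by rewrite rmorphD.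
have CN (u : R) : (- u)%:C = - u%:C by rewrite rmorphN.
have CV (u : R) : (u^-1)%:C = u%:C^-1 by rewrite fmorphV.
have rt2 : rt%:C ^+ 2 = 1 + 4 * (m * c)%:R * (1 + c%:R) :> R[i].
  rewrite -rmorphXn /= /rt sqr_sqrtr; last by rewrite addr_ge0 ?mulr_ge0 ?addr_ge0.
  by rewrite (CD 1 (4 * mc * (1 + c%:R))) (CM (4 * mc)) (CM 4) (CD 1 c%:R) -!natC.
have E1 : lam1%:C = (- 2^-1 + (m * c)%:R + (W0 + B0)%:R + 2^-1 * rt%:C) / (m * c)%:R.
  by rewrite /lam1 CM (CD (_ + T0)) (CD (_ + mc)) (CD _ mc) CN (CM 2^-1) !CV -!natC.
have E2 : lam2%:C = (- 2^-1 + (m * c)%:R + (W0 + B0)%:R - 2^-1 * rt%:C) / (m * c)%:R.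
  by rewrite /lam2 CM (CD (_ + T0)) (CD (_ + mc)) (CD _ mc) !CN (CM 2^-1) !CV -!natC.
rewrite E1 E2; have a0 : (m * c)%:R != 0 :> R[i].
  by rewrite pnatr_eq0 -lt0n muln_gt0 c1 ltnW.
have t2 : 2 != 0 :> R[i] by rewrite pnatr_eq0.
have -> : 2`!%:R = 2 :> R[i] by [].
have m0 : m%:R != 0 :> R[i] by rewrite pnatr_eq0 -lt0n ltnW.
have cc0 : c%:R != 0 :> R[i] by rewrite pnatr_eq0 -lt0n.
move: rt2; rewrite natrM; move: rt%:C (W0 + B0)%:R => r T rt2.
(* The quadratic with its square completed; the [lambda2 l] come from factoring this difference of
   squares. *)
transitivity (((x * (m%:R * c%:R) + T + (m%:R * c%:R) - 2^-1) ^+ 2 - r ^+ 2 / 4) / (m%:R * c%:R) ^+ 2).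
  by rewrite rt2; field; rewrite m0 cc0.
by field; rewrite m0 cc0.
Qed.

Let pole1 : pole R m c W0 B0 1 = T0 / mc.
Proof. by rewrite /pole addrK. Qed.

Let pole2 : pole R m c W0 B0 2 = (T0 - 1) / mc.
Proof. by rewrite /pole; congr (_ / _); rewrite /T0; ring. Qed.

Let he0 : - (2 * (m * c)%:R)^-1 <= 0 :> R.
Proof. by rewrite oppr_le0 invr_ge0 mulr_ge0. Qed.

Lemma alpha2_factor j : (j%:R + lam1) * (j%:R + lam2) =
  alpha R m c W0 B0 j 2 * ((j%:R + T0 / mc) * (j%:R + (T0 - 1) / mc)).
Proof.
have := alpha_at_lambda m2 c1 mT j lambda2P he0.
rewrite !prod_nat13 /lambda2 /= pole1 pole2 addr0.
by rewrite -alpha_alpha_at -!rmorphD -rmorphM /= => /complexI.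
Qed.

Let shift_pos (j : nat) : 0 < j%:R + T0 / mc /\ 0 < j%:R + (T0 - 1) / mc.
Proof.
have T2 : 2 <= T0 by rewrite ler_nat (leq_trans m2).
by split; rewrite ltr_wpDl // divr_gt0 ?mc_gt0 //; lra.
Qed.

Lemma alpha2_prod l : \prod_(0 <= j < l.+1) alpha R m c W0 B0 j 2 =
  gbinom (l%:R + lam1) l.+1 * gbinom (l%:R + lam2) l.+1 /
  (gbinom (l%:R + T0 / mc) l.+1 * gbinom (l%:R + (T0 - 1) / mc) l.+1).
Proof.
rewrite big_mkord !gbinom_rising.
have f0 : (l.+1)`!%:R != 0 :> R by rewrite pnatr_eq0 -lt0n fact_gt0.
set Pa := \prod_(i < l.+1) (i%:R + T0 / mc).
set Pb := \prod_(i < l.+1) (i%:R + (T0 - 1) / mc).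
have Pa0 : Pa != 0 by apply/prodf_neq0 => i _; rewrite gt_eqF //; have [] := shift_pos i.
have Pb0 : Pb != 0 by apply/prodf_neq0 => i _; rewrite gt_eqF //; have [] := shift_pos i.
set P1 := \prod_(i < l.+1) (i%:R + lam1); set P2 := \prod_(i < l.+1) (i%:R + lam2).
have h : P1 * P2 = (\prod_(j < l.+1) alpha R m c W0 B0 j 2) * (Pa * Pb).
  rewrite /P1 /P2 /Pa /Pb -!big_split /=; apply: eq_bigr => j _.
  exact: alpha2_factor.
apply: (mulIf (mulf_neq0 Pa0 Pb0)); rewrite -h.
clearbody P1 P2 Pa Pb; move: f0; move: ((l.+1)`!%:R) => f f0.
by field; rewrite Pa0 Pb0 f0.
Qed.

(** Only [i = l = 2] occurs. The terms [j = 1, 2] give [m/t - m (m-1)/(t (t-1)) = m (t-m)/(t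
    (t-1))], and this [t] cancels against the one in the first moment. *)
Lemma beta2 n : beta P c W0 B0 K n 2 =
  (W0 * c ^ 2 * m)%:R / T0 *
    ((n%:R + (T0 - m%:R) / mc) / (n%:R + (T0 - 1) / mc)).
Proof.
rewrite /beta big_nat1 big_nat1 big_nat_recl // big_nat1 /=.
rewrite (moment_power1 m2 c1 mT urnP) -[(2 + 1 - 2)%N]/1%N.
rewrite -[(1 + 2 - 1 - 2)%N]/0%N expr0 expr1 binn !bin1.
rewrite (_ : ((1 * (1 * 0 + 1) + 0) * (0 * 0 + 1) * m = m)%N); last by ring.
rewrite (_ : ((2 * (2 * 0 + 0) + (1 * 0 + 1)) * (1 * (0 * 0 + 1) + 0) * 'C(m, 2) = 'C(m, 2))%N);
  last by ring.
have T2 : 2 <= T0 by rewrite ler_nat (leq_trans m2).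
have m0 : (0 < m)%N by apply: ltnW.
have tE : (Defs.total m c W0 B0 n)%:R = T0 + n%:R * mc :> R.
  by rewrite /Defs.total natrD -mulnA natrM.
have t0 : (0 < Defs.total m c W0 B0 n)%N.
  by rewrite /Defs.total addn_gt0 (leq_trans m0).
rewrite !bin2_natr // tE.
have mcpos : 0 < mc by rewrite lt_neqAle eq_sym mc0 /=.
have n0 : 0 <= n%:R * mc by rewrite mulr_ge0 // ltW.
have -> : (W0 * c ^ 2 * m)%:R = W0%:R * c%:R ^+ 2 * m%:R :> R by rewrite natrM natrM natrX.
rewrite -/T0; move: (n%:R : R) n0 tE => k k0 _.
have T1 : 0 < T0 + k * mc - 1 by lra.
have e1 : k + (T0 - m%:R) / mc = (T0 + k * mc - m%:R) / mc.
  by move: mc0; move: mc => a a0; field.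
have e2 : k + (T0 - 1) / mc = (T0 + k * mc - 1) / mc.
  by move: mc0; move: mc => a a0; field.
rewrite e1 e2; have T00 : T0 != 0 by rewrite gt_eqF //; lra.
have t00 : T0 + k * mc != 0 by rewrite gt_eqF //; lra.
move: T00 t00 mc0 T1; move: (T0 + k * mc) => t.
move: T0 mc (m%:R : R) => T a q T00 t00 a0 t1.
have t10 : t - 1 != 0 by rewrite gt_eqF.
by field; rewrite T00 t00 t10 a0.
Qed.

Lemma urn_series2 l : urn_series P c W0 B0 K 2 l =
  (W0 * c ^ 2 * m)%:R / T0 *
  ((l%:R + (T0 - m%:R) / mc) / (l%:R + (T0 - 1) / mc) *
   (gbinom (l%:R + T0 / mc) l.+1 * gbinom (l%:R + (T0 - 1) / mc) l.+1 /
    (gbinom (l%:R + lam1) l.+1 * gbinom (l%:R + lam2) l.+1))).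
Proof. by rewrite /urn_series beta2 alpha2_prod invf_div -[LHS]mulrA. Qed.

End SecondMoment.

Theorem corollary1 (R : realType) (d : measure_display) (Om : measurableType d)
    (P : probability Om R) (m c W0 B0 : nat) (K : nat -> Om -> 'I_m.+1) :
  (2 <= m)%N -> (1 <= c)%N -> (0 < W0)%N -> (0 < B0)%N -> (m <= W0 + B0)%N ->
  urn_process P c W0 B0 K ->
  let T0 := (W0 + B0)%N in
  let mc : R := (m * c)%:R in
  [/\ (* existence of the limits *)
      forall s : nat, cvgn (fun n => moment P c W0 K n s / n%:R ^+ s),
      (* expected value *)
      (fun n => moment P c W0 K n 1 / n%:R) @ \oo
        --> ((W0 * m * c)%:R / T0%:R : R),
      (* second moment *)
      (let lam1 := (- 2^-1 + mc + T0%:R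
                    + 2^-1 * Num.sqrt (1 + 4 * mc * (1 + c%:R))) / mc in
       let lam2 := (- 2^-1 + mc + T0%:R
                    - 2^-1 * Num.sqrt (1 + 4 * mc * (1 + c%:R))) / mc in
       let a := T0%:R / mc in
       let b := (T0%:R - 1) / mc in
       let u (l : nat) : R :=
         (l%:R + (T0%:R - m%:R) / mc) / (l%:R + b) *
         (gbinom (l%:R + a) l.+1 * gbinom (l%:R + b) l.+1 /
          (gbinom (l%:R + lam1) l.+1 * gbinom (l%:R + lam2) l.+1)) in
       cvgn (series u) /\
       (fun n => (moment P c W0 K n 2 / n%:R ^+ 2)%:C : R[i]^o) @ \oo -->
         (Gamma a%:C * Gamma b%:C / (Gamma lam1%:C * Gamma lam2%:C) *
          (W0%:R ^+ 2 + (W0 * c ^ 2 * m)%:R / T0%:R * limn (series u))%:C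
            : R[i]^o)) &
      (* all moments *)
      forall s : nat, (1 <= s)%N ->
        (exists lam : nat -> R[i], is_lambda m c W0 B0 s lam) /\
        forall lam : nat -> R[i], is_lambda m c W0 B0 s lam ->
        exists G : R[i],
        let u (l : nat) : R :=
          beta P c W0 B0 K l s / \prod_(0 <= j < l.+1) alpha R m c W0 B0 j s in
        [/\ (s <= T0)%N -> G = Gamma_quot m c W0 B0 s lam 0,
            (fun e : R => Gamma_quot m c W0 B0 s lam e : R[i]^o) @ 0^'
              --> (G : R[i]^o),
            cvgn (series u) &
            (fun n => (moment P c W0 K n s / n%:R ^+ s)%:C : R[i]^o) @ \oo -->
              (G * (W0%:R ^+ s + limn (series u))%:C : R[i]^o)]].
Proof.
move=> m2 c1 W0_gt0 B0_gt0 mT urnP T0 mc.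
have lamE s := @exists_lambda R m c W0 B0 m2 c1 mT s.
split.
- case=> [|s].
    under eq_fun do rewrite (moment_power0 mT urnP) expr0 divr1.
    exact: is_cvg_cst.
  have [lam lamP] := lamE s.+1.
  have [G [_ _ _ h]] := urn_limit m2 c1 mT urnP (ltn0Sn s) lamP.
  exact: cvgP h.
- exact: moment1_cvg.
- move=> lam1 lam2 a b u.
  have lamP : is_lambda m c W0 B0 2 (@lambda2 R m c W0 B0) by apply: lambda2P.
  have [G [G2 _ cvgS lim2]] := urn_limit m2 c1 mT urnP (isT : (0 < 2)%N) lamP.
  pose k : R := (W0 * c ^ 2 * m)%:R / T0%:R.
  (* The series in the statement lacks the factor [k], so its convergence is deduced by dividing by
     [k], which is nonzero as [0 < W0]. *)
  have k0 : k != 0.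
    rewrite /k mulf_neq0 ?invr_eq0 ?pnatr_eq0 -?lt0n ?muln_gt0 ?expn_gt0 ?W0_gt0 ?c1 ?(ltnW m2) //.
    by rewrite addn_gt0 W0_gt0.
  have uE : u = k^-1 *: urn_series P c W0 B0 K 2.
    apply/funext => l; transitivity (k^-1 * urn_series P c W0 B0 K 2 l); last by [].
    rewrite (urn_series2 m2 c1 mT urnP); exact: (esym (mulKf k0 _)).
  have cu : cvgn (series u) by rewrite uE; exact: is_cvg_seriesZ.
  split => //.
  have -> : k * limn (series u) = limn (series (urn_series P c W0 B0 K 2)).
    by rewrite uE lim_seriesZ // mulVKf.
  have -> : Gamma a%:C * Gamma b%:C / (Gamma lam1%:C * Gamma lam2%:C) = G%:C.
    (* Since [2 <= m <= T0], no pole occurs for [s = 2], and the quotient at [e = 0] is itself the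
       constant. *)
    rewrite -G2 ?(leq_trans m2) // /Gamma_quot !prod_nat13 (rmorph0 (real_complex R)).
    rewrite !addr0 !poleC; congr (Gamma _%:C * Gamma _%:C / _).
      by rewrite /pole addrK.
    by rewrite /pole /b /T0; congr (_ / _); ring.
  by rewrite -rmorphM; exact: cvg_complex_real.
- move=> s s0; split; first exact: lamE.
  move=> lam lamP.
  have [G [G0 Gc cvgS hlim]] := urn_limit m2 c1 mT urnP s0 lamP.
  exists G%:C; split.
  + by move=> sT; rewrite G0.
  + exact: Gc.
  + exact: cvgS.
  + by rewrite -rmorphM; exact: cvg_complex_real.
Qed.
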